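(* Let the perturbed operator $\tilde A=A+\alpha\langle\cdot,\omega_1\rangle\omega_2\in\mathcal P_\tau(A)$, $\alpha\ne0$, possess a new eigenvalue $\lambda\in\mathbb C$ in comparison with $A$, i.e. $\lambda\in\sigma_p(\tilde A)$, $\lambda\notin\sigma_p(A)$. Then for the corresponding eigenvectors $\varphi$, $\psi$, that is $\tilde A\varphi=\lambda\varphi$ and $\tilde A^*\psi=\bar\lambda\psi$, the following relations hold for $z\in\rho(A)\cap\rho(\tilde A)$: $$(\lambda-z)\,b_z(\varphi,n_{\bar z})=1,\qquad \varphi=(A-z)(A-\lambda)^{-1}m_z;$$ $$(\bar\lambda-\bar z)\,\bar b_z(\psi,m_z)=1,\qquad \psi=(A-\bar z)(A-\bar\lambda)^{-1}n_{\bar z}.$$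
   Context: $\mathcal H$ is a separable Hilbert space with scalar product $(\cdot,\cdot)$, linear in the first argument; $A=A^*$ is a (without loss of generality strictly) positive self-adjoint operator in $\mathcal H$ with domain $\mathfrak D(A)$. $\rho(\cdot)$ denotes the set of regular points and $\sigma_p(\cdot)$ the point spectrum. Scale: for $k=1,2$, $\mathcal H_{+k}=\mathfrak D(|A|^{k/2})$ with norm $\|(|A|+I)^{k/2}\varphi\|$ (so $\mathcal H_{+2}=\mathfrak D(A)$); $\mathcal H_{-k}$ is the completion of $\mathcal H$ in the norm $\|f\|_{-k}=\|(|A|+I)^{-k/2}f\|$; $\langle\cdot,\cdot\rangle$ is the dual scalar product between $\mathcal H_{+k}$ and $\mathcal H_{-k}$. $A$ also denotes its extension by continuity to a bounded operator $\mathcal H\to\mathcal H_{-2}$, and $R_z=(A-z)^{-1}$ also the corresponding extended resolvent $\mathcal H_{-2}\to\mathcal H$. Perturbed operators. For $\omega_1\neq\omega_2$ in $\mathcal H_{-2}\setminus\mathcal H$ put $\eta_i=A^{-1}\omega_i$. The operator $A^{\omega_1,\omega_2}$, the restriction to $\mathcal H$ of $A+\langle\cdot,\omega_1\rangle\omega_2$, is defined as follows. I. If $|(A^{1/2}\eta_2,A^{1/2}\eta_1)|<\infty$, put $q=1+(A^{1/2}\eta_2,A^{1/2}\eta_1)$; one writes $A^{\omega_1,\omega_2}\in\mathcal P(A)$. II. If $(A^{1/2}\eta_2,A^{1/2}\eta_1)$ does not exist, put $q=1+\tau+(A^{1/2}(A^2+1)^{-1/2}\eta_2,A^{1/2}(A^2+1)^{-1/2}\eta_1)$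 with a parameter $\tau\in\mathbb C$; one writes $A^{\omega_1,\omega_2}\in\mathcal P_\tau(A)$. If $q\ne0$, $\mathfrak D(A^{\omega_1,\omega_2})=\{\psi=\varphi+b\eta_2:\varphi\in\mathfrak D(A),\ b=(A\varphi,\eta_1)/q\}$; if $q=0$, $\mathfrak D(A^{\omega_1,\omega_2})=\{\varphi\in\mathfrak D(A):(A\varphi,\eta_1)=0\}\dot+\{c\eta_2\}$. In each case $A^{\omega_1,\omega_2}\psi=A\varphi$. Case I is regarded as a particular case of case II. With a coupling constant $\alpha\in\mathbb C$ one considers $\tilde A=A+\alpha\langle\cdot,\omega_1\rangle\omega_2$, $\omega_i\in\mathcal H_{-2}\setminus\mathcal H$, $\|\omega_i\|_{-1}=1$, $i=1,2$; the set of such operators is also denoted $\mathcal P_\tau(A)$, the parameter $\tau$ standing in place of $\langle\omega_2,A(A^2+1)^{-1}\omega_1\rangle$. For $z\in\rho(A)\cap\rho(\tilde A)$, $n_z$, $m_z$, $b_z$ are the vectors and number in the Krein-type resolvent formula $(\tilde A-z)^{-1}=R_z+b_z(\cdot,n_{\bar z})m_z$, namely $n_z=R_z\omega_1$, $m_z=R_z\omega_2$, $-b_z^{-1}=\alpha^{-1}+\tau+\langle(A^2+1)^{-1}\omega_2,(1+\bar zA)R_{\bar z}\omega_1\rangle$.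
   Formalization: The domain of the perturbed operator is taken with b = −(Aφ,η₁)/q instead of b = (Aφ,η₁)/q; the printed sign contradicts the restriction of A+⟨·,ω₁⟩ω₂ to H and the formula for b_z, and makes the first relation false at z=0. *)

(* Defs.v *)
From HB Require Import structures.
From mathcomp Require Import all_boot all_order all_algebra.
From mathcomp Require Import all_classical all_reals all_analysis.
From mathcomp Require Export sesquilinear.
From mathcomp Require Import complex.

Set Implicit Arguments.
Unset Strict Implicit.
Unset Printing Implicit Defensive.

Import Order.TTheory GRing.Theory Num.Theory.
Import numFieldNormedType.Exports.

Local Open Scope ring_scope.
Local Open Scope classical_set_scope.

(* MathComp-Analysis attaches topologies to sorts of numClosedFieldType, so the
   complex numbers R[i] are named as such a structure. *)
Definition CC (R : realType) : numClosedFieldType := R[i]%C.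

(* A partially defined operator is identified with its graph:
   T (x, y) reads "x is in the domain of T and T x = y". *)
Section Graphs.

Definition gdom (U V : Type) (T : set (U * V)) : set U :=
  [set x | exists y, T (x, y)].

(* T x, meaningful for x in the domain of a single-valued T. *)
Definition ap (U : Type) (V : choiceType) (v0 : V) (T : set (U * V)) (x : U) :
  V := xget v0 [set y | T (x, y)].

Definition ginv (U V : Type) (T : set (U * V)) : set (V * U) :=
  [set p | T (p.2, p.1)].

Definition gcomp (U V W : Type) (S : set (V * W)) (T : set (U * V)) :
  set (U * W) := [set p | exists2 y, T (p.1, y) & S (y, p.2)].

(* T - z *)
Definition gshift (K : pzRingType) (U : lmodType K) (T : set (U * U)) (z : K) :
  set (U * U) := [set p | T (p.1, p.2 + z *: p.1)].

(* Extension of T : U -> V by continuity to an operator X -> Y, where U and V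
   are mapped by i and j into the larger spaces X and Y. *)
Definition gext (U V : Type) (X Y : topologicalType) (i : U -> X) (j : V -> Y)
  (T : set (U * V)) : set (X * Y) :=
  [set p | exists u : nat -> U, exists v : nat -> V,
     [/\ forall n, T (u n, v n),
         i (u n) @[n --> \oo] --> p.1 & j (v n) @[n --> \oo] --> p.2]].

End Graphs.

Definition separable_space (T : topologicalType) : Prop :=
  exists D : set T, countable D /\ dense D.

Section Hilbert.
Variables (R : realType) (H : completeNormedModType (CC R)).
Local Notation C := (CC R).

(* The scalar product is linear in its first argument. *)
Definition hilbert (dot : {dot H for Num.conj}) : Prop :=
  forall x : H, dot x x = `|x| ^+ 2.

Variable dot : {dot H for Num.conj}.

Definition gadj (T : set (H * H)) : set (H * H) :=
  [set p | forall u v, T (u, v) -> dot v p.1 = dot u p.2].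

(* Linearity and single-valuedness of T follow from T = T^*, T^* being the
   adjoint of a densely defined operator. *)
Definition selfadjoint (T : set (H * H)) : Prop :=
  dense (gdom T) /\ gadj T = T.

Definition positive (T : set (H * H)) : Prop :=
  forall x y, T (x, y) -> 0 <= dot y x.

(* T >= c I for some c > 0, so that 0 is a regular point of a self-adjoint T *)
Definition strictly_positive (T : set (H * H)) : Prop :=
  exists2 c : C, 0 < c & forall x y, T (x, y) -> c * dot x x <= dot y x.

(* S = T^{1/2}: such an S exists and is unique for every positive self-adjoint
   operator T. *)
Definition is_sqrt (T S : set (H * H)) : Prop :=
  [/\ selfadjoint S, positive S & gcomp S S = T].

Definition regular_points (T : set (H * H)) : set C :=
  [set z | (forall y, exists! x, gshift T z (x, y)) /\
     exists M : C, forall x y, gshift T z (x, y) -> `|x| <= M * `|y|].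

Definition eigenvector (T : set (H * H)) (l : C) (x : H) : Prop :=
  x != 0 /\ T (x, l *: x).

Definition point_spectrum (T : set (H * H)) : set C :=
  [set l | exists x, eigenvector T l x].

Variable A : set (H * H).

(* (A + I)^{-1} *)
Definition invA1 : set (H * H) := ginv (gshift A (-1)).

(* (A^2 + 1)^{-1} *)
Definition invA2 : set (H * H) := ginv (gshift (gcomp A A) (-1)).

(* X is the completion of H in the norm |N f|, with embedding j. *)
Definition is_completion (N : set (H * H)) (X : completeNormedModType C)
    (j : {linear H -> X}) : Prop :=
  (forall f, `|j f| = `|ap 0 N f|) /\ dense (range j).

(* The chain H < H_{-1} < H_{-2} for a positive A, |A| = A. The completions are
   determined up to isometry; rootA1 stands for (A + I)^{-1/2}. *)
Record scale (rootA1 : set (H * H)) := Scale {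
  Hm1 : completeNormedModType C;
  Hm2 : completeNormedModType C;
  emb1 : {linear H -> Hm1};
  emb2 : {linear H -> Hm2};
  incl : {linear Hm1 -> Hm2};
  emb1P : is_completion rootA1 emb1;
  emb2P : is_completion invA1 emb2;
  incl_continuous : continuous incl;
  incl_emb : forall f, incl (emb1 f) = emb2 f
}.

(* <u, w> for u in H_{+k} and w in H_{-k}: the extension by continuity of the
   functional f |-> (u, f) from H to H_{-k}. *)
Definition dual (X : completeNormedModType C) (j : {linear H -> X})
    (u : H) (w : X) : C :=
  ap 0 (gext j (idfun : C -> C) [set p : H * C | p.2 = dot u p.1]) w.

(* [rootA] stands for A^{1/2}, [rootA2] for (A^2 + 1)^{-1/2}. *)
Variables (rootA rootA1 rootA2 : set (H * H)) (S : scale rootA1).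
Local Notation j := (@emb2 _ S).

(* The extension of A to an operator from H to H_{-2} *)
Definition extA (h : H) : Hm2 S := ap 0 (gext idfun j A) h.

(* The extension of R_z = (A - z)^{-1} to H_{-2} *)
Definition extR (z : C) (w : Hm2 S) : H :=
  ap 0 (gext j idfun (ginv (gshift A z))) w.

(* The extension of (A^2 + 1)^{-1} to an operator from H_{-2} to H_{+2} *)
Definition extA2 (w : Hm2 S) : H := ap 0 (gext j idfun invA2) w.

(* eta = A^{-1} w *)
Definition eta (w : Hm2 S) : H := ap 0 (ginv (gext idfun j A)) w.

(* The restriction to H of A + <., w1> w2, in terms of e_i = A^{-1} w_i.
   For psi = phi + b e2 one has A psi + <psi, w1> w2
   = A phi + (b + <psi, w1>) w2, which is in H exactly when
   b = - <psi, w1> = - (A phi, e1) - b <e2, w1>, that is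
   q b = - (A phi, e1) with q = 1 + <e2, w1>; hence the sign of b below. *)
Definition perturbation (e1 e2 : H) (q : C) : set (H * H) :=
  [set p | exists phi b,
     [/\ A (phi, p.2), p.1 = phi + b *: e2 &
         if q == 0 then dot p.2 e1 = 0 else b = - (dot p.2 e1 / q)]].

(* (A^{1/2} (A^2 + 1)^{-1/2} e2, A^{1/2} (A^2 + 1)^{-1/2} e1) *)
Definition regularized (e1 e2 : H) : C :=
  dot (ap 0 (gcomp rootA rootA2) e2) (ap 0 (gcomp rootA rootA2) e1).

(* T = A + a <., w1> w2 belongs to P_tau(A). The coupling constant a is absorbed
   in the second vector, a <., w1> w2 = <., w1> (a w2), which multiplies both
   scalar products and tau by a.
   First case: (A^{1/2} eta2, A^{1/2} eta1) exists; then w2 is in H_{-1} and tau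
   is the number <w2, A (A^2 + 1)^{-1} w1>, a pairing of H_{-1} with H_{+1}.
   Second case: it does not exist and tau is a free parameter. *)
Definition in_P_tau (w1 w2 : Hm2 S) (a tau : C) (T : set (H * H)) : Prop :=
  ([/\ gdom rootA (eta w1), gdom rootA (eta w2),
       exists2 v2 : Hm1 S, incl S v2 = w2 &
         tau = (dual (@emb1 _ S) (ap 0 A (extA2 w1)) v2)^* &
       T = perturbation (eta w1) (a *: eta w2)
             (1 + a * dot (ap 0 rootA (eta w2)) (ap 0 rootA (eta w1)))])
  \/
  (~ (gdom rootA (eta w1) /\ gdom rootA (eta w2)) /\
   T = perturbation (eta w1) (a *: eta w2)
         (1 + a * (tau + regularized (eta w1) (eta w2)))).

(* The vectors and the number of the resolvent formula
   (T - z)^{-1} = R_z + b_z (., n_{z^*}) m_z. *)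
Definition n_ (w1 : Hm2 S) (z : C) : H := extR z w1.

Definition m_ (w2 : Hm2 S) (z : C) : H := extR z w2.

(* - b_z^{-1} = a^{-1} + tau
     + <(A^2 + 1)^{-1} w2, (1 + z^* A) R_{z^*} w1>,
   a pairing of H_{+2} with H_{-2}. *)
Definition b_ (w1 w2 : Hm2 S) (a tau z : C) : C :=
  - (a^-1 + tau
     + dual j (extA2 w2) (j (extR z^* w1) + z^* *: extA (extR z^* w1)))^-1.

End Hilbert.

(* Main.v *)
Require Import Defs.
From HB Require Import structures.
From mathcomp Require Import all_boot all_order all_algebra.
From mathcomp Require Import all_classical all_reals all_analysis.
From mathcomp Require Import complex ring.
Import Order.TTheory GRing.Theory Num.Theory.
Import numFieldNormedType.Exports.
Local Open Scope ring_scope.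
Local Open Scope classical_set_scope.

(* With G = A^{-1}, membership in the domain and in the extended spaces is
   expressed by G alone: eta w is the limit of G f_n for f_n -> w in H_{-2}, and
   m_z = e2 + z G m_z, n_{z^*} = e1 + z^* G n_{z^*} where e_i = A^{-1} w_i.  An
   eigenvector of T is, after scaling, phi = e2 + lambda G phi, with
   q = - alpha lambda (phi, e1), and one of T^* is psi = e1 + lambda^* G psi,
   with q = - alpha lambda (e2, psi).  Symmetry of G turns two such fixed-point
   equations into
     (l - z) (phi, n) = l (phi, e1) - z (e2, n),
   and q = 1 + alpha (tau + (A (A^2 + 1)^{-1} e2, e1)) in both cases of the
   definition of T, so that the right-hand side is 1 / b_z.  That 1 / b_z does
   not vanish follows from z being regular for T.  The only use of the square
   roots is in that formula for q, which needs (A^2 + 1)^{-1/2} to commute with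
   A^{-1/2}. *)

(** * The order of the complex numbers and dominated convergence *)

Section Convergence.
Set Implicit Arguments.
Unset Strict Implicit.
Variable R : realType.
Local Notation C := (CC R).

(** The order of [C] compares only numbers with equal imaginary parts, so arguments by archimedean
    bounds or infima pass through real parts. *)
Lemma CC_ge0E (x : C) : 0 <= x -> x = (complex.Re x)%:C%C.
Proof. by move=> /ger0_real; case: x => a b; rewrite complex_real => /eqP ->. Qed.

Lemma Re_le (x y : C) : x <= y -> complex.Re x <= complex.Re y.
Proof. by rewrite lecE => /andP[]. Qed.

Lemma ReD (x y : C) : complex.Re (x + y) = complex.Re x + complex.Re y.
Proof. by case: x; case: y. Qed.

Lemma le_of_Re (x y : C) : 0 <= x -> 0 <= y ->
  complex.Re x <= complex.Re y -> x <= y.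
Proof. by move=> /CC_ge0E-> /CC_ge0E-> /= h; rewrite lecE /= eqxx. Qed.

Lemma CC_natE n : n%:R = (n%:R : R)%:C%C :> C.
Proof. exact/esym/(rmorph_nat (real_complex R)). Qed.

Lemma CC_natmul_bounded (a K : C) : 0 <= a -> 0 <= K ->
  (forall n : nat, n%:R * a <= K) -> a = 0.
Proof.
move=> a0 K0 aK; apply/eqP/negPn/negP => an0.
have {a0 an0} a0 : 0 < a by rewrite lt_def an0.
have K'0 : 0 <= complex.Re (K / a).
  by move: (divr_ge0 K0 (ltW a0)); rewrite lecE /= => /andP[].
have := aK (Num.bound (complex.Re (K / a))).
rewrite -ler_pdivlMr// CC_natE => /Re_le /= h.
by have := archi_boundP K'0; rewrite ltNge h.
Qed.

Lemma CC_inv_natP (e : C) : 0 < e -> \forall n \near \oo, n.+1%:R^-1 < e.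
Proof.
move=> e0; have e'0 : 0 < complex.Re e by move: e0; rewrite ltcE /= => /andP[].
near=> n.
rewrite [e]CC_ge0E ?ltW// CC_natE -[X in X < _]fmorphV.
rewrite ltcE /= eqxx /=; near: n.
by apply: near_infty_natSinv_lt (PosNum e'0).
Unshelve. all: by end_near. Qed.

Section Bounds.
Variables X Y : normedModType C.

(** Replaces an arbitrary complex constant by a positive one, by which an epsilon can be divided. *)
Lemma le_norm1M (K x y : C) : 0 <= x -> 0 <= y -> x <= K * y ->
  x <= (`|K| + 1) * y.
Proof.
move=> x0 y0 xKy; apply: (le_trans xKy).
rewrite -[X in X <= _](ger0_norm (le_trans x0 xKy)) normrM (ger0_norm y0).
by rewrite ler_wpM2r// lerDl.
Qed.

Lemma cvg_dominated (K : C) (u : nat -> X) (v : nat -> Y) a b :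
  (forall n, `|v n - b| <= K * `|u n - a|) -> u n @[n --> \oo] --> a ->
  v n @[n --> \oo] --> b.
Proof.
move=> uv /cvgrPdist_lt ua; apply/cvgrPdist_lt => e e0.
have K0 : 0 < `|K| + 1 by rewrite ltr_wpDl.
near=> n; rewrite distrC.
apply: (le_lt_trans (le_norm1M (normr_ge0 _) (normr_ge0 _) (uv n))).
rewrite mulrC -ltr_pdivlMr// distrC; near: n; apply: ua; exact: divr_gt0.
Unshelve. all: by end_near. Qed.

(** The source of all limits that define extended operators: a bounded map sends a convergent
    sequence to a Cauchy one. *)
Lemma cvg_cauchy_dominated (Z : completeNormedModType C) (K : C)
    (u : nat -> X) (v : nat -> Z) (a : X) :
  (forall n m, `|v n - v m| <= K * `|u n - u m|) -> u n @[n --> \oo] --> a ->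
  exists b : Z, v n @[n --> \oo] --> b.
Proof.
move=> uv ua; have K0 : 0 < `|K| + 1 by rewrite ltr_wpDl.
have uv' n m : `|v n - v m| <= (`|K| + 1) * `|u n - u m|.
  exact: le_norm1M.
have : cvg (v n @[n --> \oo]).
  apply: cauchy_cvg; apply/cauchyP => e e0.
  have /cvgrPdist_lt/(_ (e / (`|K| + 1) / 2)) := ua.
  move=> /(_ _)[|N _ Nu]; first by rewrite !divr_gt0.
  exists (v N); exists N => // n /= Nn; rewrite -ball_normE /=.
  apply: (le_lt_trans (uv' _ _)); rewrite mulrC -ltr_pdivlMr//.
  rewrite [ltRHS]splitr -(subrKA a) (le_lt_trans (ler_normD _ _))//.
  by rewrite ltrD// ?[`|u N - a|]distrC; apply: Nu => /=.
by move=> /cvg_ex.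
Qed.

End Bounds.

Lemma cvg_seq_unique (X : normedModType C) (u : nat -> X) (a b : X) :
  u n @[n --> \oo] --> a -> u n @[n --> \oo] --> b -> a = b.
Proof. exact: norm_cvg_unique. Qed.

Lemma dense_seq (X : normedModType C) (D : set X) : dense D ->
  forall w : X, exists2 f : nat -> X, (forall n, D (f n)) & f n @[n --> \oo] --> w.
Proof.
move=> dD w.
have /choice[f fP] n : exists x, D x /\ `|w - x| < n.+1%:R^-1.
  have [||x [/= bx Dx]] := dD (ball w (n.+1%:R^-1 : C)).
  - by exists w; exact: ballxx.
  - exact: ball_open.
  - by exists x; split => //; move: bx; rewrite -ball_normE.
exists f => [n|]; first by have [] := fP n.
apply/cvgrPdist_lt => e e0; near=> n.
by have [_ /lt_trans] := fP n; apply; near: n; exact: CC_inv_natP.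
Unshelve. all: by end_near. Qed.

End Convergence.

(** * Cauchy-Schwarz inequality and orthogonal projection *)

Section InnerProduct.
Set Implicit Arguments.
Unset Strict Implicit.
Variables (R : realType) (H : completeNormedModType (CC R)).
Local Notation C := (CC R).
Variable dot : {dot H for Num.conj}.

Lemma dotC x y : dot x y = (dot y x)^*.
Proof. by rewrite hermC expr0 mul1r. Qed.

Lemma dotDl x y z : dot (x + y) z = dot x z + dot y z.
Proof. exact: linearDl. Qed.

Lemma dotDr x y z : dot z (x + y) = dot z x + dot z y.
Proof. exact: linearDr. Qed.

Lemma dotBl x y z : dot (x - y) z = dot x z - dot y z.
Proof. exact: linearBl. Qed.

Lemma dotBr x y z : dot z (x - y) = dot z x - dot z y.
Proof. exact: linearBr. Qed.

Lemma dotZl a x z : dot (a *: x) z = a * dot x z.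
Proof. exact: linearZl_LR. Qed.

Lemma dotZr a x z : dot z (a *: x) = a^* * dot z x.
Proof. exact: linearZr_LR. Qed.

Lemma dot0l z : dot 0 z = 0.
Proof. exact: linear0l. Qed.

Lemma dot0r z : dot z 0 = 0.
Proof. exact: linear0r. Qed.

Hypothesis hdot : hilbert dot.

Lemma dot_ge0 x : 0 <= dot x x.
Proof. by rewrite hdot exprn_ge0. Qed.

Lemma dot_eq0 x : dot x x = 0 -> x = 0.
Proof. by rewrite hdot => /eqP; rewrite expf_eq0 /= normr_eq0 => /eqP. Qed.

Lemma dot_ext x y : (forall u, dot u x = dot u y) -> x = y.
Proof.
move=> xy; apply/eqP; rewrite -subr_eq0; apply/eqP/dot_eq0.
by rewrite dotBr xy subrr.
Qed.

(** Pythagoras for the projection of [x] on the line of [d]; it yields both Cauchy-Schwarz and the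
    near orthogonality of near minimizers. *)
Lemma norm_residual x d : d != 0 ->
  `|x - (dot x d / `|d| ^+ 2) *: d| ^+ 2 =
  `|x| ^+ 2 - `|dot x d| ^+ 2 / `|d| ^+ 2.
Proof.
move=> d0; have d' : `|d| != 0 by rewrite normr_eq0.
rewrite -!hdot dotBl !dotBr !dotZl !dotZr [dot d x]dotC normCK !hdot.
rewrite rmorphM /= fmorphV /= rmorphXn /=.
rewrite [`|d|^*]conj_Creal ?normr_real//.
by field.
Qed.

Lemma cauchy_schwarz x y : `|dot x y| <= `|x| * `|y|.
Proof.
have [->|y0] := eqVneq y 0; first by rewrite dot0r !normr0 mulr0.
rewrite -ler_sqr ?nnegrE ?mulr_ge0// exprMn -ler_pdivrMr ?exprn_gt0 ?normr_gt0//.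
by rewrite -subr_ge0 -norm_residual// exprn_ge0.
Qed.

Lemma cvg_dotr (u : nat -> H) (a x : H) : u n @[n --> \oo] --> a ->
  (dot x (u n) : C^o) @[n --> \oo] --> (dot x a : C^o).
Proof.
by apply: (@cvg_dominated _ _ C^o `|x|) => n; rewrite -dotBr cauchy_schwarz.
Qed.

Lemma cvg_dotl (u : nat -> H) (a x : H) : u n @[n --> \oo] --> a ->
  (dot (u n) x : C^o) @[n --> \oo] --> (dot a x : C^o).
Proof.
apply: (@cvg_dominated _ _ C^o `|x|) => n.
by rewrite -dotBl mulrC cauchy_schwarz.
Qed.

Lemma dense_dot_ext (D : set H) x y : dense D ->
  (forall u, D u -> dot u x = dot u y) -> x = y.
Proof.
move=> dD xy; apply: dot_ext => u.
have [f Df fu] := dense_seq dD u.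
apply: (cvg_seq_unique (cvg_dotl (x := x) fu)).
under eq_fun do rewrite xy//.
exact: cvg_dotl.
Qed.

(** The infimum is taken over the real parts, where completeness is available. *)
Lemma almost_min (T : Type) (P : set T) (f : T -> C) (e : C) : 0 < e ->
  (forall x, 0 <= f x) -> P !=set0 ->
  exists2 x, P x & forall s, P s -> f x <= f s + e.
Proof.
move=> e0 f0 [x0 Px0].
pose E := [set complex.Re (f x) | x in P].
have e'0 : 0 < complex.Re e by move: e0; rewrite ltcE => /andP[].
have hE : has_inf E.
  split; first by exists (complex.Re (f x0)), x0.
  by exists 0 => _ [x _ <-]; have /Re_le := f0 x.
have [_ [x Px <-] xE] := inf_adherent e'0 hE.
exists x => // s Ps.
have fsE : inf E <= complex.Re (f s) by apply: ge_inf => //; [case: hE|exists s].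
apply: le_of_Re => //; first by rewrite addr_ge0 ?f0 ?(ltW e0).
by rewrite ReD; apply/ltW/(lt_le_trans xE); rewrite lerD2r.
Qed.

(* A minimizing sequence is almost orthogonal to [D]; since the differences of
   its terms lie in [D], this makes it a Cauchy sequence. *)
Lemma projection (D : set H) y : D 0 ->
  (forall a u v, D u -> D v -> D (a *: u + v)) ->
  (forall (u : nat -> H) (a : H), (forall n, D (u n)) -> u n @[n --> \oo] --> a -> D a) ->
  exists2 r, D r & forall d, D d -> dot (y - r) d = 0.
Proof.
move=> D0 Dlin Dcl.
have /choice[r rP] (n : nat) : exists r, D r /\
    forall d, D d -> `|dot (y - r) d| <= n.+1%:R^-1 * `|d|.
  (* The tolerance is a square because it will bound |(y - r, d)|^2 / |d|^2. *)
  have e0 : 0 < (n.+1%:R^-1 : C) ^+ 2 by rewrite exprn_gt0 ?invr_gt0.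
  have [||r Dr rmin] := @almost_min _ D (fun r => `|y - r| ^+ 2) _ e0.
  - by move=> ?; rewrite exprn_ge0.
  - by exists 0.
  exists r; split=> // d Dd.
  have [->|d0] := eqVneq d 0; first by rewrite dot0r !normr0 mulr0.
  (* The competitor is [r] plus the projection of y - r on [d]. *)
  have := rmin _ (Dlin (dot (y - r) d / `|d| ^+ 2) _ _ Dd Dr).
  rewrite opprD addrA addrAC norm_residual// -addrA lerDl addrC subr_ge0 => h.
  rewrite -ler_sqr ?nnegrE ?mulr_ge0 ?invr_ge0//.
  by rewrite exprMn -ler_pdivrMr ?exprn_gt0 ?normr_gt0.
have rr n m : `|r n - r m| <= n.+1%:R^-1 + m.+1%:R^-1.
  have [->|nm] := eqVneq (r n - r m) 0.
    by rewrite normr0 addr_ge0 ?invr_ge0.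
  rewrite -(@ler_pM2r _ `|r n - r m|) ?normr_gt0// -expr2 -hdot mulrDl.
  have Dd : D (r n - r m).
    rewrite addrC -scaleN1r; apply: Dlin; [by have [] := rP m|by have [] := rP n].
  have -> : dot (r n - r m) (r n - r m) =
      dot (y - r m) (r n - r m) - dot (y - r n) (r n - r m).
    by rewrite -dotBl; congr (dot _ _); rewrite opprB [RHS]addrC subrKA.
  have [_ /(_ _ Dd) rm] := rP m; have [_ /(_ _ Dd) rn] := rP n.
  rewrite -[X in X <= _]ger0_norm.
    by apply: (le_trans (ler_normB _ _)); rewrite addrC lerD.
  rewrite -dotBl; have -> : y - r m - (y - r n) = r n - r m.
    by rewrite opprB addrC subrKA.
  exact: dot_ge0.
have : cvg (r n @[n --> \oo]).
  apply: cauchy_cvg; apply/cauchyP => e e0.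
  have [N _ Ne] := @CC_inv_natP R (e / 2) (divr_gt0 e0 (ltr0Sn _ 1)).
  exists (r N); exists N => // n /= Nn; rewrite -ball_normE /=.
  by rewrite (le_lt_trans (rr _ _))// [ltRHS]splitr ltrD// Ne/=.
move=> /cvg_ex[p rp]; exists p; first by apply: Dcl rp => n; have [] := rP n.
move=> d Dd.
have h1 : (dot (y - r n) d : C^o) @[n --> \oo] --> (dot (y - p) d : C^o).
  by apply: cvg_dotl; apply: cvgB => //; exact: cvg_cst.
apply: (cvg_seq_unique h1); apply/cvgr0Pnorm_lt => e e0.
have d0 : 0 < `|d| + 1 by rewrite ltr_wpDl.
near=> n; have [_ /(_ _ Dd) /le_lt_trans] := rP n; apply.
apply: (@le_lt_trans _ _ (n.+1%:R^-1 * (`|d| + 1))).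
  by rewrite ler_wpM2l ?invr_ge0// lerDl.
rewrite -ltr_pdivlMr//; near: n; apply: CC_inv_natP; exact: divr_gt0.
Unshelve. all: by end_near. Qed.

End InnerProduct.

(** * Self-adjoint graphs and their resolvents *)

Section SelfAdjoint.
Set Implicit Arguments.
Unset Strict Implicit.
Variables (R : realType) (H : completeNormedModType (CC R)).
Local Notation C := (CC R).
Variable dot : {dot H for Num.conj}.
Hypothesis hdot : hilbert dot.

Lemma norm_le_of_sqr (x : H) (K : C) : 0 <= K ->
  `|x| ^+ 2 <= K * `|x| -> `|x| <= K.
Proof.
move=> K0; have [->|x0] := eqVneq x 0; first by rewrite normr0.
by rewrite expr2 ler_pM2r ?normr_gt0.
Qed.

Variable A : set (H * H).
Hypothesis hA : selfadjoint dot A.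

(** The inclusion of the adjoint in [A]: linearity and closedness of the graph are both checked by
    pairing against it. *)
Lemma sa_adj x y : (forall u v, A (u, v) -> dot v x = dot u y) -> A (x, y).
Proof. by case: hA => _ {2}<- h u v /h. Qed.

Lemma sa_sym x y u v : A (x, y) -> A (u, v) -> dot v x = dot u y.
Proof. by case: hA => _ {1}<- h /h. Qed.

Lemma sa_lin a x y x' y' : A (x, y) -> A (x', y') ->
  A (a *: x + x', a *: y + y').
Proof.
move=> xy xy'; apply: sa_adj => u v uv.
by rewrite !(dotDr, dotZr) (sa_sym xy uv) (sa_sym xy' uv).
Qed.

Lemma sa0 : A (0, 0).
Proof. by apply: sa_adj => u v _; rewrite !dot0r. Qed.

Lemma saZ a x y : A (x, y) -> A (a *: x, a *: y).
Proof. by move=> /(sa_lin a)/(_ sa0); rewrite !addr0. Qed.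

Lemma saD x y x' y' : A (x, y) -> A (x', y') -> A (x + x', y + y').
Proof. by move=> /(sa_lin 1) h /h; rewrite !scale1r. Qed.

Lemma sa_fun x y y' : A (x, y) -> A (x, y') -> y = y'.
Proof.
move=> xy xy'; apply: (dense_dot_ext hdot (proj1 hA)) => u [v uv].
by rewrite -(sa_sym xy uv) (sa_sym xy' uv).
Qed.

Lemma sa_closed (u v : nat -> H) x y : (forall n, A (u n, v n)) ->
  u n @[n --> \oo] --> x -> v n @[n --> \oo] --> y -> A (x, y).
Proof.
move=> uv ux vy; apply: sa_adj => s t st.
apply: (cvg_seq_unique (cvg_dotr hdot (x := t) ux)).
under eq_fun do rewrite (sa_sym (uv _) st).
exact: cvg_dotr.
Qed.

Lemma sa_realquad x y : A (x, y) -> dot y x = dot x y.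
Proof. by move=> xy; apply: sa_sym. Qed.

(** Surjectivity of A - z with an a priori bound; by linearity of the graph the bound also gives
    injectivity. *)
Definition resolvent_at (z : C) : Prop :=
  (forall y, exists x, gshift A z (x, y)) /\
  exists M : C, forall x y, gshift A z (x, y) -> `|x| <= M * `|y|.

Lemma gshift_lin z a x y x' y' : gshift A z (x, y) -> gshift A z (x', y') ->
  gshift A z (a *: x + x', a *: y + y').
Proof.
rewrite /gshift /= => xy xy'; have := sa_lin a xy xy'; congr A; congr pair.
by rewrite !scalerDr scalerA mulrC -scalerA addrACA.
Qed.

(** The bound makes the range of A - z closed, and a vector orthogonal to that range is an
    eigenvector of [A] for the conjugate of [z], or zero. *)
Lemma sa_onto z (M : C) :
  (forall x y, gshift A z (x, y) -> `|x| <= M * `|y|) ->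
  (forall x, A (x, z^* *: x) -> x = 0) ->
  forall y, exists x, gshift A z (x, y).
Proof.
move=> Mb ker y.
pose D := [set y | exists x, gshift A z (x, y)].
have D0 : D 0 by exists 0; rewrite /gshift /= scaler0 addr0; exact: sa0.
have Dlin a u v : D u -> D v -> D (a *: u + v).
  by move=> [x xu] [x' xv]; exists (a *: x + x'); exact: gshift_lin.
have Dcl (u : nat -> H) (a : H) : (forall n, D (u n)) ->
    u n @[n --> \oo] --> a -> D a.
  move=> /choice[x xu] ua.
  have xM n m : `|x n - x m| <= M * `|u n - u m|.
    have := Mb _ _ (gshift_lin (-1) (xu m) (xu n)).
    by rewrite !scaleN1r ![- _ + _]addrC.
  have [b xb] := cvg_cauchy_dominated xM ua.
  exists b; apply: (sa_closed xu xb).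
  by apply: cvgD => //; exact: cvgZr.
have [r Dr rP] := projection hdot y D0 Dlin Dcl.
suff /ker/eqP : A (y - r, z^* *: (y - r)) by rewrite subr_eq0 => /eqP ->.
apply: sa_adj => u v uv; rewrite dotZr conjCK.
have /rP : D (v - z *: u) by exists u; rewrite /gshift /= subrK.
move=> /(congr1 Num.conj); rewrite -dotC rmorph0 dotBl dotZl => /eqP.
by rewrite subr_eq0 => /eqP.
Qed.

Lemma norm_bound (x y : H) (M : C) : `|x| <= M * `|y| -> `|x| <= `|M| * `|y|.
Proof.
move=> h; rewrite -(normr_id y) -normrM ger0_norm//; exact: le_trans h.
Qed.

Lemma regular_resolvent z : regular_points A z -> resolvent_at z.
Proof. by move=> [h b]; split => // y; have [x [xy _]] := h y; exists x. Qed.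

Lemma resolvent_conj z : resolvent_at z -> resolvent_at z^*.
Proof.
move=> [onto [M Mb]].
have Mb' x y : gshift A z^* (x, y) -> `|x| <= `|M| * `|y|.
  move=> xy; have [t tx] := onto x; apply: norm_le_of_sqr; first by rewrite mulr_ge0.
  have := sa_sym xy tx; rewrite /= dotDl dotDr dotZl dotZr conjCK => /addIr.
  move=> xE.
  rewrite -[leLHS]ger0_norm ?exprn_ge0// -(hdot x) xE.
  apply: (le_trans (cauchy_schwarz hdot _ _)).
  rewrite mulrAC ler_wpM2r//; exact/norm_bound/Mb.
split; last by exists `|M|.
apply: (sa_onto Mb') => x; rewrite conjCK => xzx.
have /Mb : gshift A z (x, 0) by rewrite /gshift /= add0r.
by rewrite normr0 mulr0 normr_le0 => /eqP.
Qed.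

(** For z = i or -i the cross terms cancel: |(A - z) x|^2 = |A x|^2 + |x|^2. *)
Lemma imaginary_resolvent z : z^* = - z -> `|z| = 1 -> resolvent_at z.
Proof.
move=> zN z1.
have Mb w x y : w^* = - w -> `|w| = 1 -> gshift A w (x, y) ->
    `|x| <= 1 * `|y|.
  move=> wN w1; rewrite /gshift /= => xy; rewrite mul1r.
  rewrite -ler_sqr ?nnegrE// -(hdot x) -(hdot y).
  pose a := y + w *: x; have e1 : dot a x = dot x a by exact: sa_realquad.
  have -> : y = a - w *: x by rewrite addrK.
  rewrite !(dotBl, dotBr, dotZl, dotZr) wN e1.
  have ww : w * w = -1.
    by rewrite -[w * w]opprK -mulrN -wN -normCK w1 expr1n.
  rewrite [leRHS](_ : _ = dot a a - (w * w) * dot x x); last by ring.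
  by rewrite ww mulN1r opprK lerDr dot_ge0.
have zN' : z^*^* = - z^* by rewrite zN rmorphN /= zN.
have z1' : `|z^*| = 1 by rewrite norm_conjC.
split; last by exists 1 => x y; apply: Mb.
apply: (sa_onto (fun x y => Mb _ x y zN z1)) => x xzx.
have /(Mb _ _ _ zN' z1') : gshift A z^* (x, 0) by rewrite /gshift /= add0r.
by rewrite normr0 mulr0 normr_le0 => /eqP.
Qed.

Lemma coercive_resolvent z (c : C) : 0 < c -> z^* = z ->
  (forall x y, gshift A z (x, y) -> c * dot x x <= dot y x) -> resolvent_at z.
Proof.
move=> c0 zR cP.
have Mb x y : gshift A z (x, y) -> `|x| <= c^-1 * `|y|.
  move=> xy; apply: norm_le_of_sqr; first by rewrite mulr_ge0// invr_ge0 ltW.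
  rewrite -mulrA ler_pdivlMl// -(hdot x); have := cP _ _ xy.
  have h : 0 <= c * dot x x by rewrite mulr_ge0 ?(ltW c0)// dot_ge0.
  move=> h1; apply: (le_trans h1); rewrite -[leLHS]ger0_norm ?(le_trans h h1)//.
  exact: cauchy_schwarz.
split; last by exists c^-1.
apply: (sa_onto Mb) => x; rewrite zR => xzx.
have /Mb : gshift A z (x, 0) by rewrite /gshift /= add0r.
by rewrite normr0 mulr0 normr_le0 => /eqP.
Qed.

Lemma strictly_positive_resolvent : strictly_positive dot A ->
  resolvent_at 0 /\ resolvent_at (- 1).
Proof.
move=> [c c0 cP]; split.
  apply: (coercive_resolvent c0); first by rewrite rmorph0.
  by move=> x y; rewrite /gshift /= scale0r addr0; apply: cP.
apply: (@coercive_resolvent _ 1) => //; first by rewrite rmorphN rmorph1.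
move=> x y; rewrite /gshift /= scaleN1r mul1r => /cP.
rewrite dotBl => h; rewrite -subr_ge0; apply: le_trans h.
by rewrite mulr_ge0 ?(ltW c0)// dot_ge0.
Qed.

(* Solves A^2 x + x = y by inverting A + i and A - i. *)
Lemma sqr1_onto y : exists x p, A (x, p) /\ A (p, y - x).
Proof.
have [h1 _] : resolvent_at 'i.
  by apply: imaginary_resolvent; rewrite ?conjCi ?normCi.
have [h2 _] : resolvent_at (- 'i).
  by apply: imaginary_resolvent; rewrite ?rmorphN /= ?conjCi ?normrN ?normCi.
have [t tP] := h2 y; have [x xP] := h1 t.
exists x, (t + 'i *: x); split => //.
have := saD tP (saZ 'i xP); rewrite /gshift /=; congr A; congr pair.
rewrite scalerDr scalerA -expr2 sqrCi scaleN1r scaleNr addrA.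
by rewrite subrK.
Qed.

(** Pairing A^2 x + x = f = A g with [x] gives |p|^2 + |x|^2 = (p, g), where p = A x. Bounding by
    A^{-1} f rather than by [f] is what lets (A^2 + 1)^{-1} extend to H_{-2}. *)
Lemma sqr1_bound x p f : A (x, p) -> A (p, f - x) ->
  forall g, A (g, f) -> `|x| <= `|g| /\ `|p| <= `|g|.
Proof.
move=> xp pf g gf.
have e : `|p| ^+ 2 + `|x| ^+ 2 = dot p g.
  have := sa_sym pf xp; rewrite dotBr -!hdot => ->.
  by rewrite subrK dotC (sa_sym xp gf) -dotC.
have e0 : 0 <= dot p g by rewrite -e addr_ge0 ?exprn_ge0.
have eb : `|p| ^+ 2 + `|x| ^+ 2 <= `|p| * `|g|.
  by rewrite e -[leLHS]ger0_norm// cauchy_schwarz.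
have pg : `|p| <= `|g|.
  apply: norm_le_of_sqr => //; rewrite mulrC.
  by apply: le_trans eb; rewrite lerDl exprn_ge0.
split => //; rewrite -ler_sqr ?nnegrE//.
apply: (@le_trans _ _ (`|p| * `|g|)); last by rewrite expr2 ler_wpM2r.
by apply: le_trans eb; rewrite lerDr exprn_ge0.
Qed.

Lemma sqr1_inj x p : A (x, p) -> A (p, - x) -> x = 0.
Proof.
move=> xp px.
have [] := @sqr1_bound x p 0 xp _ 0 (sa0); first by rewrite sub0r.
by rewrite normr0 normr_le0 => /eqP.
Qed.

End SelfAdjoint.

(** * A bounded operator commuting with the square of a positive contraction commutes with the
    contraction *)

Section SquareRootCommutes.
Set Implicit Arguments.
Unset Strict Implicit.
Variables (R : realType) (H : completeNormedModType (CC R)).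
Local Notation C := (CC R).
Variable dot : {dot H for Num.conj}.
Hypothesis hdot : hilbert dot.
Variables (s F : {linear H -> H}) (K : C).
Hypothesis s_sym : forall x y, dot (s x) y = dot x (s y).
Hypothesis s_ge0 : forall x, 0 <= dot (s x) x.
Hypothesis s_le1 : forall x, `|s x| <= `|x|.
Hypothesis s_inj : forall x, s x = 0 -> x = 0.
Hypothesis K_ge0 : 0 <= K.
Hypothesis F_bound : forall x, `|F x| <= K * `|x|.
Hypothesis F_sqr : forall x, F (s (s x)) = s (s (F x)).

Let up x := x + s x.
Let dn x := x - s x.
Let D x := s (F x) - F (s x).

Lemma sqrt_real x : dot x (s x) = dot (s x) x.
Proof. by rewrite s_sym. Qed.

(** From s - s^2 = s (1 - s)^2 + s^2 (1 - s), where both summands are non-negative forms, the second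
    because [s] is a contraction. *)
Lemma sqrt_sqr_le x : dot (s x) (s x) <= dot (s x) x.
Proof.
rewrite -subr_ge0.
have -> : dot (s x) x - dot (s x) (s x) = dot (s (dn x)) (dn x) +
    (dot (s x) (s x) - dot (s x) (s (s x))).
  by rewrite /dn (raddfB s) !(dotBl, dotBr) !s_sym; ring.
rewrite addr_ge0 ?s_ge0// subr_ge0 -s_sym.
rewrite -[leLHS]ger0_norm//; apply: (le_trans (cauchy_schwarz hdot _ _)).
by rewrite (hdot (s x)) expr2 ler_wpM2r.
Qed.

Lemma norm_subr_sqrt_le x : `|dn x| <= `|x|.
Proof.
rewrite -ler_sqr ?nnegrE// -(hdot x) -(hdot (dn x)).
rewrite /dn !(dotBl, dotBr) sqrt_real.
have h := sqrt_sqr_le x; have h' := s_ge0 x.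
rewrite -subr_ge0.
have -> : dot x x - (dot x x - dot (s x) x - (dot (s x) x - dot (s x) (s x)))
  = dot (s x) x + (dot (s x) x - dot (s x) (s x)) by ring.
by rewrite addr_ge0// subr_ge0.
Qed.

Lemma norm_addr_sqrt_ge x : `|x| ^+ 2 + `|s x| ^+ 2 <= `|up x| ^+ 2.
Proof.
rewrite -(hdot x) -(hdot (s x)) -(hdot (up x)).
rewrite /up !(dotDl, dotDr) sqrt_real -subr_ge0.
have -> : dot x x + dot (s x) x + (dot (s x) x + dot (s x) (s x)) -
  (dot x x + dot (s x) (s x)) = dot (s x) x + dot (s x) x by ring.
by rewrite addr_ge0.
Qed.

Lemma iter_up_s n x : s (iter n up x) = iter n up (s x).
Proof. by elim: n => //= n <-; rewrite /up raddfD. Qed.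

Lemma iter_up_mono n x : `|x| <= `|iter n up x|.
Proof.
elim: n => //= n /le_trans; apply; rewrite -ler_sqr ?nnegrE//.
by apply: le_trans (norm_addr_sqrt_ge _); rewrite lerDl exprn_ge0.
Qed.

(** Each application of 1 + s adds at least |s x|^2 to the squared norm, since [s] commutes with the
    iterates and these do not shrink [s x]. *)
Lemma iter_up_ge n x : n%:R * `|s x| ^+ 2 <= `|iter n up x| ^+ 2.
Proof.
elim: n => [|n IH]; first by rewrite mul0r exprn_ge0 ?normr_ge0.
rewrite -natr1 mulrDl mul1r /=; apply: le_trans (norm_addr_sqrt_ge _).
by rewrite lerD// iter_up_s ler_sqr ?nnegrE// iter_up_mono.
Qed.

(** As [F] commutes with s^2, s D + D s = s^2 F - F s^2 = 0. *)
Lemma addr_sqrt_D x : up (D x) = D (dn x).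
Proof.
rewrite /up /D /dn !(raddfB s, raddfB F) /= F_sqr.
rewrite opprB addrACA [RHS]addrACA.
by congr (_ + _); rewrite addrC.
Qed.

(* [D] anticommutes with [s], so [(1 + s)^n (D x) = D ((1 - s)^n x)] stays
   bounded, whereas [|(1 + s)^n y|^2 >= n |s y|^2]. *)
Lemma sqrt_commute x : F (s x) = s (F x).
Proof.
suff /eqP : D x = 0 by rewrite subr_eq0 => /eqP.
have itD n : iter n up (D x) = D (iter n dn x).
  by elim: n => //= n ->; apply: addr_sqrt_D.
have itdn n : `|iter n dn x| <= `|x|.
  by elim: n => //= n; apply: le_trans; apply: norm_subr_sqrt_le.
have Db y : `|D y| <= (2 * K) * `|y|.
  rewrite -mulrA mulr_natl mulr2n (le_trans (ler_normB _ _))// lerD//.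
    exact: le_trans (s_le1 _) (F_bound _).
  by apply: (le_trans (F_bound _)); rewrite ler_wpM2l.
apply/s_inj/eqP; rewrite -normr_eq0 -sqrf_eq0; apply/eqP.
apply: (@CC_natmul_bounded _ _ ((2 * K * `|x|) ^+ 2)).
- by rewrite exprn_ge0.
- by rewrite exprn_ge0// !mulr_ge0.
- move=> n; apply: (le_trans (iter_up_ge n _)).
  rewrite ler_sqr ?nnegrE ?mulr_ge0// itD.
  by apply: (le_trans (Db _)); rewrite ler_wpM2l// mulr_ge0.
Qed.

End SquareRootCommutes.

(** * From graphs to linear maps *)

Section Functions.
Set Implicit Arguments.
Unset Strict Implicit.
Variables (R : realType) (H : completeNormedModType (CC R)).
Local Notation C := (CC R).
Variable dot : {dot H for Num.conj}.
Hypothesis hdot : hilbert dot.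

(** Replaces a relational inverse by a total linear map, so that later identities are computed with
    functions. *)
Lemma graph_inverse (T : set (H * H)) :
  (forall a x y x' y', T (x, y) -> T (x', y') -> T (a *: x + x', a *: y + y')) ->
  (forall y, exists x, T (x, y)) -> (forall x, T (x, 0) -> x = 0) ->
  exists F : {linear H -> H}, forall x y, T (x, y) <-> x = F y.
Proof.
move=> Tlin /choice[f fT] inj.
have Tinj x x' y : T (x, y) -> T (x', y) -> x = x'.
  move=> xy /(Tlin (-1))/(_ xy); rewrite !scaleN1r ![- _ + _]addrC subrr.
  by move=> /inj/eqP; rewrite subr_eq0 => /eqP.
have flin : linear f.
  by move=> a x y; apply: (Tinj _ _ (a *: x + y)) => //; apply: Tlin.
pose F : {linear H -> H} :=
  HB.pack_for {linear H -> H} f (GRing.isLinear.Build C H H _ f flin).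
exists F => x y; split=> [xy|->]; last exact: fT.
exact: Tinj xy (fT y).
Qed.

Variable A : set (H * H).
Hypothesis hA : selfadjoint dot A.

Lemma resolvent_inverse z : resolvent_at A z ->
  exists F : {linear H -> H}, (forall x y, gshift A z (x, y) <-> x = F y) /\
  exists2 M : C, 0 <= M & forall y, `|F y| <= M * `|y|.
Proof.
move=> [onto [M Mb]]; have [||F FP] := @graph_inverse (gshift A z) _ onto.
- by move=> a x y x' y'; apply: (gshift_lin hA).
- by move=> x /Mb; rewrite normr0 mulr0 normr_le0 => /eqP.
exists F; split => //; exists `|M| => // y.
by apply/norm_bound/Mb/FP.
Qed.

Lemma inverse_sym (F : {linear H -> H}) : (forall x y, A (x, y) <-> x = F y) ->
  forall x y, dot (F x) y = dot x (F y).
Proof.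
by move=> FP x y; apply/esym/(sa_sym hA); exact/FP.
Qed.

Lemma total_fun : (forall x, exists y, A (x, y)) ->
  exists s : {linear H -> H}, forall x y, A (x, y) <-> y = s x.
Proof.
move=> tot; have [|//||s sP] := @graph_inverse (ginv A).
- by move=> a x y x' y'; rewrite /ginv /=; exact: (sa_lin hA).
- by move=> x; rewrite /ginv /= => h; exact: (sa_fun hdot hA h (sa0 hA)).
by exists s => x y; rewrite -sP.
Qed.

Lemma total_fun_sym (s : {linear H -> H}) : (forall x y, A (x, y) <-> y = s x) ->
  forall x y, dot (s x) y = dot x (s y).
Proof.
by move=> sP x y; apply: (sa_sym hA); exact/sP.
Qed.

Lemma sqr1_inverse : exists N : {linear H -> H},
  forall x f, gshift (gcomp A A) (- 1) (x, f) <-> x = N f.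
Proof.
apply: graph_inverse => [a x y x' y'|y|x].
- rewrite /gshift /gcomp /= !scaleN1r => -[p /= xp py] [p' /= xp' py'].
  exists (a *: p + p') => /=; first exact: (sa_lin hA).
  by have := sa_lin hA a py py'; congr A; congr pair; rewrite scalerBr opprD addrACA.
- have [x [p [xp py]]] := sqr1_onto hdot hA y.
  by exists x, p => //=; rewrite scaleN1r.
- move=> [p /= xp px]; apply: (sqr1_inj hdot hA xp).
  by move: px; rewrite scaleN1r add0r.
Qed.

End Functions.

(** * Square roots of everywhere defined and of invertible operators *)

Section SquareRoots.
Set Implicit Arguments.
Unset Strict Implicit.
Variables (R : realType) (H : completeNormedModType (CC R)).
Local Notation C := (CC R).
Variable dot : {dot H for Num.conj}.
Hypothesis hdot : hilbert dot.

Lemma sqrt_total (T S : set (H * H)) (F : {linear H -> H}) : is_sqrt dot T S ->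
  (forall x y, T (x, y) <-> y = F x) ->
  exists s : {linear H -> H}, [/\ forall x y, S (x, y) <-> y = s x,
    forall x y, dot (s x) y = dot x (s y), forall x, 0 <= dot (s x) x &
    forall x, s (s x) = F x].
Proof.
move=> [Ssa Spos SST] FP.
have [x|s sP] := total_fun hdot Ssa.
  have : T (x, F x) by exact/FP.
  by rewrite -SST => -[y /= xy _]; exists y.
exists s; split => //; first exact: (total_fun_sym Ssa).
  by move=> x; apply: Spos; exact/sP.
by move=> x; apply/FP; rewrite -SST; exists (s x); exact/sP.
Qed.

Lemma sqrt_inverse (T S : set (H * H)) (G : {linear H -> H}) : is_sqrt dot T S ->
  (forall x y, T (x, y) <-> x = G y) ->
  exists F : {linear H -> H}, [/\ forall x y, S (x, y) <-> x = F y,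
    forall x y, dot (F x) y = dot x (F y) & forall x, F (F x) = G x].
Proof.
move=> [Ssa _ SST] GP.
have [|y|x x0|F FP] := @graph_inverse _ _ S.
- by move=> a x y x' y'; exact: (sa_lin Ssa).
- have : T (G y, y) by exact/GP.
  by rewrite -SST => -[p /= _ py]; exists p.
- have : T (x, 0) by rewrite -SST; exists 0 => //; exact: (sa0 Ssa).
  by move=> /GP ->; rewrite raddf0.
exists F; split => //; first exact: (inverse_sym Ssa).
by move=> x; apply/GP; rewrite -SST; exists (F x); exact/FP.
Qed.

End SquareRoots.

(** * Extension by continuity from a dense subspace *)

Section Extension.
Set Implicit Arguments.
Unset Strict Implicit.
Variable R : realType.
Local Notation C := (CC R).

Lemma apP (U : Type) (V : choiceType) (v0 : V) (T : set (U * V)) x y :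
  T (x, y) -> T (x, ap v0 T x).
Proof. by move=> xy; rewrite /ap; case: xgetP => [? _ //|/(_ y)]. Qed.

Lemma ap_eq (U : Type) (V : choiceType) (v0 : V) (T : set (U * V)) x y :
  T (x, y) -> (forall y', T (x, y') -> y' = y) -> ap v0 T x = y.
Proof. by move=> xy; apply; exact: apP xy. Qed.

Variables (H Y : completeNormedModType C) (X : normedModType C).
Variables (j : {linear H -> X}) (L : {linear H -> Y}) (K : C).
Hypothesis jdense : dense (range j).
Hypothesis LK : forall f, `|L f| <= K * `|j f|.

Lemma dense_range_seq (w : X) : exists f : nat -> H, j (f n) @[n --> \oo] --> w.
Proof.
have [g /= gj gw] := dense_seq jdense w.
have /choice[f fg] n : exists f, j f = g n by have [f] := gj n; exists f.
by exists f; under eq_fun do rewrite fg.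
Qed.

Lemma dominated_limit (f : nat -> H) (w : X) : j (f n) @[n --> \oo] --> w ->
  exists l : Y, L (f n) @[n --> \oo] --> l.
Proof.
by apply: cvg_cauchy_dominated => n m; rewrite -!raddfB; apply: LK.
Qed.

(** Independence of the approximating sequence; it makes the value picked by [ap] from a [gext] the
    expected one. *)
Lemma dominated_limit_unique (f g : nat -> H) (w : X) (l : Y) :
  j (f n) @[n --> \oo] --> w -> j (g n) @[n --> \oo] --> w ->
  L (f n) @[n --> \oo] --> l -> L (g n) @[n --> \oo] --> l.
Proof.
move=> fw gw fl.
have d0 : L (g n - f n) @[n --> \oo] --> (0 : Y).
  have j0 : j (g n - f n) @[n --> \oo] --> (0 : X).
    rewrite -[0](subrr w); under eq_fun do rewrite raddfB.
    exact: cvgB.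
  by apply: (cvg_dominated _ j0) => n; rewrite !subr0; apply: LK.
rewrite -[l]add0r.
rewrite (_ : (fun n => L (g n)) = (fun n => L (g n - f n) + L (f n))).
  exact: cvgD.
by apply/funext => n; rewrite -raddfD subrK.
Qed.

End Extension.

(** * The extended operators on H_{-2} in terms of A^{-1} *)

Section Scale.
Set Implicit Arguments.
Unset Strict Implicit.
Variables (R : realType) (H : completeNormedModType (CC R)).
Local Notation C := (CC R).
Variable dot : {dot H for Num.conj}.
Hypothesis hdot : hilbert dot.
Variable A : set (H * H).
Hypothesis hA : selfadjoint dot A.
Variables (rootA1 : set (H * H)) (S : scale A rootA1).
Local Notation j := (@emb2 _ _ _ _ S).
Local Notation eta := Defs.eta.
Variables (G J : {linear H -> H}) (M : C).
Hypothesis GP : forall x y, A (x, y) <-> x = G y.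
Hypothesis M_ge0 : 0 <= M.
Hypothesis G_bound : forall y, `|G y| <= M * `|y|.
Hypothesis G_ge0 : forall y, 0 <= dot (G y) y.
Hypothesis JP : forall x y, gshift A (- 1) (x, y) <-> x = J y.

Lemma G_sym x y : dot (G x) y = dot x (G y).
Proof. exact: (inverse_sym hA GP). Qed.

Lemma G_graph y : A (G y, y).
Proof. exact/GP. Qed.

Lemma G_inj x y : G x = G y -> x = y.
Proof.
by move=> xy; apply: (sa_fun hdot hA (G_graph x)); rewrite xy; apply: G_graph.
Qed.

Lemma cvg_G (u : nat -> H) (a : H) : u n @[n --> \oo] --> a ->
  G (u n) @[n --> \oo] --> G a.
Proof. by apply: (@cvg_dominated _ _ _ M) => n; rewrite -(raddfB G) G_bound. Qed.

Lemma J_G y : J y = G (y - J y).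
Proof.
by apply/GP; have := (JP (J y) y).2 erefl; rewrite /gshift /= scaleN1r.
Qed.

(** The resolvent identity between A^{-1} and (A + 1)^{-1}. *)
Lemma G_split f : G f = J f + G (J f).
Proof. by rewrite {1}(J_G f) -(raddfD G) subrK. Qed.

Lemma emb2_norm f : `|j f| = `|J f|.
Proof.
have [-> _] := emb2P S; congr `|_|.
apply: ap_eq; first by rewrite /invA1 /ginv /=; exact/JP.
by move=> y; rewrite /invA1 /ginv /= => /JP.
Qed.

(** With [emb2_le_G] this makes |G f| a norm equivalent to that of H_{-2}, so convergence there can
    be tested after applying A^{-1}. *)
Lemma G_le_emb2 f : `|G f| <= (1 + M) * `|j f|.
Proof.
rewrite {1}G_split emb2_norm mulrDl mul1r (le_trans (ler_normD _ _))// lerD2l.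
exact: G_bound.
Qed.

(** With t = J f, positivity of [G] gives |t|^2 <= (t + G t, t) = (G f, t), and Cauchy-Schwarz
    applies. *)
Lemma emb2_le_G f : `|j f| <= 1 * `|G f|.
Proof.
rewrite mul1r emb2_norm; set t := J f.
apply: norm_le_of_sqr => //.
have h : dot t t <= dot (G f) t by rewrite G_split dotDl lerDl.
rewrite -(hdot t); apply: (le_trans h).
rewrite -[leLHS]ger0_norm ?(le_trans _ h) ?dot_ge0//.
exact: cauchy_schwarz.
Qed.

Lemma eta_spec (w : Hm2 S) (f : nat -> H) : j (f n) @[n --> \oo] --> w ->
  G (f n) @[n --> \oo] --> eta w.
Proof.
move=> fw; have [l fl] := dominated_limit G_le_emb2 fw.
suff -> : eta w = l by [].
apply: ap_eq.
  by exists (fun n => G (f n)), f; split => // n; exact: G_graph.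
move=> y [u [v [uv /= uy vw]]].
have {uy}vy : G (v n) @[n --> \oo] --> y.
  by rewrite (_ : (fun n => G (v n)) = u)//; apply/funext => n; apply/esym/GP.
by apply: (cvg_seq_unique vy); apply: dominated_limit_unique fw vw fl; apply: G_le_emb2.
Qed.

Lemma approx (w : Hm2 S) : exists f : nat -> H, j (f n) @[n --> \oo] --> w.
Proof. by apply: dense_range_seq; have [] := emb2P S. Qed.

(** Used in contrapositive form: if [w] is not in H, then [eta w] is not in the domain of [A]. If
    eta w = G x, then |j (f n) - j x| is at most |G (f n) - eta w|, which tends to 0. *)
Lemma range_emb2 (w : Hm2 S) x : A (eta w, x) -> range j w.
Proof.
move=> /GP ewx; have [f fw] := approx w; exists x => //.
have jx : j (f n) @[n --> \oo] --> j x.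
  apply: (@cvg_dominated _ _ _ 1 (fun n => G (f n)) _ (eta w)).
    by move=> n; rewrite ewx -!raddfB; apply: emb2_le_G.
  exact: eta_spec.
exact: (cvg_seq_unique jx).
Qed.

(** The identity R_z = G + z G R_z on H, carried to H_{-2} by continuity. *)
Lemma extR_spec z (w : Hm2 S) : resolvent_at A z ->
  extR z w = eta w + z *: G (extR z w).
Proof.
move=> /(resolvent_inverse hA)[Rz [RzP [K K0 Kb]]].
(* With the factors in this order [Rz f] is controlled by [G f], hence by the norm of H_{-2}. *)
have RzG f : Rz f = G f + z *: Rz (G f).
  apply/esym/RzP; rewrite /gshift /=.
  have := (RzP (Rz (G f)) (G f)).2 erefl; rewrite /gshift /= => /(saZ hA z).
  exact: (saD hA (G_graph f)).
have Rzb f : `|Rz f| <= ((1 + `|z| * K) * (1 + M)) * `|j f|.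
  rewrite {1}RzG (le_trans (ler_normD _ _))// normrZ -mulrA.
  apply: (@le_trans _ _ ((1 + `|z| * K) * `|G f|)).
    by rewrite mulrDl mul1r lerD2l -mulrA ler_wpM2l.
  rewrite ler_wpM2l//; last exact: G_le_emb2.
  by rewrite addr_ge0// mulr_ge0.
have [f fw] := approx w; have [h fh] := dominated_limit Rzb fw.
(* One existing limit excludes the default value 0 of [ap]; the equation is then proved for the
   sequence behind the chosen value. *)
have : gext j idfun (ginv (gshift A z)) (w, extR z w).
  apply: (@apP _ _ _ _ _ h); exists f, (fun n => Rz (f n)); split => // n.
  exact/RzP.
move: (extR z w) => {fw fh}{}h [{}f [r [/= fr fw rh]]].
have rE n : r n = G (f n) + z *: G (r n).
  by have /GP := fr n; rewrite /= raddfD /= linearZ.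
apply: (cvg_seq_unique rh); under eq_fun do rewrite rE.
apply: cvgD; first exact: eta_spec.
by apply: cvgZr; exact: cvg_G.
Qed.

Lemma extA_spec (h : H) : exists f : nat -> H,
  G (f n) @[n --> \oo] --> h /\ j (f n) @[n --> \oo] --> extA S h.
Proof.
have [u /= uP uh] := dense_seq (proj1 hA) h.
have /choice[v uv] n : exists v, A (u n, v) by have [v] := uP n; exists v.
have uE n : u n = G (v n) by apply/GP.
have ju n m : `|j (v n) - j (v m)| <= 1 * `|u n - u m|.
  by rewrite -(raddfB j) !uE -(raddfB G); apply: emb2_le_G.
have [x vx] := cvg_cauchy_dominated ju uh.
have : gext idfun j A (h, extA S h) by apply: (@apP _ _ _ _ _ x); exists u, v.
move=> [u' [v' [/= uv' u'h v'h]]]; exists v'; split => //.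
by rewrite (_ : (fun n => G (v' n)) = u')//; apply/funext => n; apply/esym/GP.
Qed.

(** The equation A^2 g + g = w after applying A^{-2}, so that [w] enters only through [eta w]. *)
Lemma extA2_spec (w : Hm2 S) : extA2 w = G (eta w - G (extA2 w)).
Proof.
have [N NP] := sqr1_inverse hdot hA.
have NG f : N f = G (G (f - N f)).
  have := (NP (N f) f).2 erefl; rewrite /gshift /= scaleN1r => -[p /= /GP xp /GP pf].
  by rewrite -pf.
have Nb f : `|N f| <= (1 + M) * `|j f|.
  apply: (le_trans _ (G_le_emb2 f)).
  have xp : A (N f, G (f - N f)) by apply/GP; exact: NG.
  have [] := sqr1_bound hdot hA xp (G_graph _) (G_graph f) => //.
have [f fw] := approx w; have [h fh] := dominated_limit Nb fw.
have : gext j idfun (invA2 A) (w, extA2 w).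
  by apply: (@apP _ _ _ _ _ h); exists f, (fun n => N (f n)); split => // n; exact/NP.
move: (extA2 w) => {fw fh}{}h [{}f [r [/= fr fw rh]]].
have rE n : r n = G (G (f n) - G (r n)).
  have rN : r n = N (f n) by apply/NP; exact: fr.
  by rewrite rN {1}NG raddfB.
apply: (cvg_seq_unique rh); under eq_fun do rewrite rE.
apply: cvg_G; apply: cvgB; [exact: eta_spec|exact: cvg_G].
Qed.

Lemma dual_spec p (w : Hm2 S) : dual dot j (G p) w = dot p (eta w).
Proof.
have lim f : j (f n) @[n --> \oo] --> w ->
    (dot (G p) (f n) : C^o) @[n --> \oo] --> (dot p (eta w) : C^o).
  move=> /eta_spec fw; under eq_fun do rewrite G_sym.
  exact: (cvg_dotr hdot).
have [f fw] := approx w; apply: ap_eq.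
  by exists f, (fun n => dot (G p) (f n)); split => //; exact: lim.
move=> y [u [v [/= uv /lim uw vy]]].
have vE : v = (fun n => dot (G p) (u n)) by apply/funext => n; rewrite uv.
have vy' : (v n : C^o) @[n --> \oo] --> (y : C^o) by exact: vy.
by rewrite vE in vy'; exact: (cvg_seq_unique vy' uw).
Qed.

Lemma eta_extA (h : H) z : eta (j h + z *: extA S h) = G h + z *: h.
Proof.
have [f [fh jf]] := extA_spec h.
have jw : j (h + z *: f n) @[n --> \oo] --> j h + z *: extA S h.
  under eq_fun do rewrite raddfD /= linearZ.
  by apply: cvgD; [exact: cvg_cst|exact: cvgZr].
apply: (cvg_seq_unique (eta_spec jw)).
under eq_fun do rewrite raddfD /= linearZ.
by apply: cvgD; [exact: cvg_cst|exact: cvgZr].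
Qed.

(** Isolates the dependence on [z] in the bracket of [b_]: with g = extA2 w2 the two terms z (G g,
    n) cancel, leaving only z (eta w2, n). *)
Lemma b_bracket (w1 w2 : Hm2 S) z n : n = eta w1 + z^* *: G n ->
  dual dot j (extA2 w2) (j n + z^* *: extA S n) =
  dot (extA2 w2) (eta w1) + z * dot (eta w2) n.
Proof.
move=> nE; rewrite extA2_spec dual_spec eta_extA -extA2_spec.
set g := extA2 w2; have gE : g = G (eta w2 - G g) := extA2_spec w2.
rewrite dotDr -G_sym -gE {1}nE dotDr !dotZr conjCK dotBl [dot (G g) n]G_sym.
by ring.
Qed.

End Scale.

(** * Eigenvectors of the rank one perturbation and of its adjoint *)

Section RankOne.
Set Implicit Arguments.
Unset Strict Implicit.
Variables (R : realType) (H : completeNormedModType (CC R)).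
Local Notation C := (CC R).
Variable dot : {dot H for Num.conj}.
Hypothesis hdot : hilbert dot.
Variable A : set (H * H).
Hypothesis hA : selfadjoint dot A.
Variable G : {linear H -> H}.
Hypothesis GP : forall x y, A (x, y) <-> x = G y.

Let GZ b x : G (b *: x) = b *: G x.
Proof. exact: linearZ. Qed.

(** Expanding (phi, n) by either equation leaves the same term (G phi, n), which is eliminated. For
    l = z it says z (phi, e1) = z (e2, n). *)
Lemma pairing e1 e2 phi n l z : phi = e2 + l *: G phi -> n = e1 + z^* *: G n ->
  (l - z) * dot phi n = l * dot phi e1 - z * dot e2 n.
Proof.
move=> phiE nE.
have h1 : dot phi n = dot e2 n + l * dot (G phi) n.
  by rewrite {1}phiE dotDl dotZl.
have h2 : dot phi n = dot phi e1 + z * dot (G phi) n.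
  by rewrite {1}nE dotDr dotZr conjCK (inverse_sym hA GP).
by rewrite mulrBl {1}h2 h1; ring.
Qed.

(** The operator inverted is A - z: with (A - z) y = phi, the vector (A - l) y = phi + (z - l) y
    satisfies the fixed-point equation of [m], so it is [m] by injectivity of A - z. *)
Lemma resolvent_ratio e m phi l z : resolvent_at A z ->
  m = e + z *: G m -> phi = e + l *: G phi ->
  gcomp (gshift A z) (ginv (gshift A l)) (m, phi).
Proof.
move=> [onto [M Mb]] mE phiE; have [y yP] := onto phi.
exists y => //; rewrite /ginv /gshift /=.
suff -> : m = phi + (z - l) *: y.
  by rewrite scalerBl addrA subrK; apply: yP.
have yE : y = G (phi + z *: y) by exact/GP.
set m' := phi + _.
have m'E : m' = e + z *: G m'.
  have -> : e = phi - l *: G phi by rewrite {1}phiE addrK.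
  rewrite /m' {1}yE !(raddfD G) /= !GZ !scalerDr !scalerA scalerBl.
  by rewrite [(z - l) * z]mulrC !addrA; congr (_ + _); rewrite addrAC.
apply/eqP; rewrite -subr_eq0 -normr_le0.
have /Mb : gshift A z (m - m', 0).
  rewrite /gshift /= add0r; apply/GP; rewrite GZ (raddfB G).
  by rewrite {1}mE {1}m'E scalerBr opprD addrACA subrr add0r.
by rewrite normr0 mulr0.
Qed.

Variables (e1 e2 : H) (a q : C).
Hypothesis a_neq0 : a != 0.
Local Notation T := (perturbation dot A e1 (a *: e2) q).

(** The scaling makes the coefficient of [e2] equal to 1; this coefficient is non-zero, as otherwise
    [phi0] would be an eigenvector of [A]. *)
Lemma right_eigenvector l phi0 : ~ point_spectrum A l ->
  eigenvector T l phi0 -> exists2 c : C, c != 0 &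
    let phi := c *: phi0 in
    phi = e2 + l *: G phi /\ q = - (a * (l * dot phi e1)).
Proof.
move=> hl [phi0_neq0 [u [b [/= Au phiE hb]]]].
have uE : u = l *: G phi0 by move/GP: Au; rewrite GZ.
have b0 : b != 0.
  apply/eqP => b0; apply: hl; exists phi0; split=> //.
  by apply/GP; rewrite GZ -uE phiE b0 scale0r addr0.
have ab0 : b * a != 0 by rewrite mulf_neq0.
exists (b * a)^-1; first by rewrite invr_eq0.
split.
  rewrite {1}phiE scalerDr [b *: _]scalerA [_ *: ((b * a) *: _)]scalerA mulVf//.
  by rewrite scale1r addrC uE GZ !scalerA mulrC.
move: hb; rewrite !dotZl.
have -> : a * (l * ((b * a)^-1 * dot phi0 e1)) = (l * dot phi0 e1) / b.
  by field; rewrite b0.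
(* For q = 0 the domain condition is itself (l phi0, e1) = 0, so both forms of the domain give one
   formula. *)
case: eqP => [-> ->|/eqP q0 bE]; first by rewrite mul0r oppr0.
have -> : l * dot phi0 e1 = - b * q by rewrite bE; field.
by rewrite mulNr mulNr opprK mulrAC mulfV// mul1r.
Qed.

(** The adjoint relation is tested on the vectors G y + b a e2 of the domain of [T]; this determines
    [psi0] up to the coefficient [g] of [e1], by which one divides. *)
Lemma left_eigenvector l psi0 : e1 != 0 -> ~ point_spectrum A l ->
  eigenvector (gadj dot T) l^* psi0 -> exists2 c : C, c != 0 &
    let psi := c *: psi0 in
    psi = e1 + l^* *: G psi /\ q = - (a * (l * dot e2 psi)).
Proof.
move=> e10 hl [psi0_neq0 adj].
have {adj}adj y b : (if q == 0 then dot y e1 = 0 else b = - (dot y e1 / q)) ->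
    dot y psi0 = dot (G y + b *: (a *: e2)) (l^* *: psi0).
  by move=> h; apply: adj; exists (G y), b; split => //; exact/GP.
suff [g psiE qE] : exists2 g, psi0 = l^* *: G psi0 + g *: e1 &
    q * g^* = - (a * (l * dot e2 psi0)).
  (* If g = 0, then [psi0] is an eigenvector of [A]; its eigenvalue is real, hence equal to [l],
     which is excluded. *)
  have g0 : g != 0.
    apply/eqP => g0; apply: hl; exists psi0; split => //.
    have h : A (psi0, l^* *: psi0).
      by apply/GP; rewrite GZ {1}psiE g0 scale0r addr0.
    have := sa_realquad hA h; rewrite dotZl dotZr conjCK => lE.
    suff <- : l^* = l by [].
    apply: (mulIf _ lE); apply/eqP => /(dot_eq0 hdot)/eqP.
    by rewrite (negbTE psi0_neq0).
  exists g^-1; first by rewrite invr_eq0.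
  split.
    rewrite {1}psiE scalerDr [_ *: (g *: _)]scalerA mulVf// scale1r addrC GZ.
    by rewrite !scalerA [g^-1 * _]mulrC.
  have g0' : g^* != 0 by rewrite conjC_eq0.
  rewrite dotZr fmorphV /=.
  have -> : a * (l * ((g^*)^-1 * dot e2 psi0)) = (a * (l * dot e2 psi0)) / g^*.
    by field.
  by rewrite -mulNr -qE mulfK.
case: (eqVneq q 0) => q0.
  rewrite q0 eqxx in adj.
  pose x := psi0 - l^* *: G psi0.
  have xP y : dot y e1 = 0 -> dot y x = 0.
    move=> /(adj y 0); rewrite scale0r addr0 dotBr => ->.
    by rewrite !dotZr (inverse_sym hA GP) subrr.
  (* For q = 0 the vector [x] is orthogonal to everything orthogonal to [e1], so it is its own
     projection on [e1]. The choice y = 0, b = 1 below gives l (e2, psi0) = 0. *)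
  pose c := dot x e1 / dot e1 e1.
  have e1e1 : dot e1 e1 != 0.
    by apply: contra_neq e10 => /(dot_eq0 hdot).
  have yE : dot (x - c *: e1) e1 = 0 by rewrite dotBl dotZl /c divfK// subrr.
  exists c.
    suff : x - c *: e1 = 0.
      by rewrite /x => /eqP; rewrite subr_eq0 subr_eq addrC => /eqP.
    by apply: (dot_eq0 hdot); rewrite dotBr dotZr yE xP// mulr0 subrr.
  rewrite q0 mul0r; have := adj 0 1 (dot0l _ _).
  rewrite dot0l raddf0 add0r scale1r dotZr dotZl conjCK => h.
  by apply/esym/eqP; rewrite oppr_eq0 mulrCA; apply/eqP.
rewrite (negbTE q0) in adj.
(* Substituting b = - (y, e1) / q in the adjoint relation shows the coefficient of (y, e1), whose
   conjugate is [g]. *)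
exists (- (a * (l * dot e2 psi0)) / q)^*; last by rewrite conjCK mulrC divfK.
apply: (dot_ext hdot) => y; rewrite (adj y _ erefl).
rewrite !(dotDl, dotDr, dotZl, dotZr) !conjCK (inverse_sym hA GP).
by field.
Qed.

(* If the bracket vanished, [m = R_z w2] would be an eigenvector of [T] at the
   regular point [z]. *)
Lemma bracket_neq0 z m n : ~ gdom A e2 -> regular_points T z ->
  m = e2 + z *: G m -> n = e1 + z^* *: G n -> q + a * (z * dot e2 n) != 0.
Proof.
move=> e2D [Tz _] mE nE; apply/eqP => q0.
have := pairing mE nE; rewrite subrr mul0r => /esym/eqP.
rewrite subr_eq0 => /eqP me.
have [x [_ xuniq]] := Tz 0.
have x0 : x = 0.
  apply: xuniq; rewrite /gshift /= scaler0 addr0; exists 0, 0; split.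
  - exact: (sa0 hA).
  - by rewrite scale0r addr0.
  - by rewrite dot0l mul0r oppr0; case: ifP.
have xm : x = m.
  (* Here m = z G m + a^{-1} (a e2); the domain condition on a^{-1} is the vanishing of the bracket
     once z (m, e1) is replaced by z (e2, n). *)
  apply: xuniq; rewrite /gshift /= add0r; exists (z *: G m), a^-1; split => /=.
  - by apply/GP; rewrite GZ.
  - by rewrite scalerA mulVf// scale1r addrC.
  - rewrite dotZl me; case: eqP => [q00|/eqP qn0].
      move: q0; rewrite q00 add0r => /eqP.
      by rewrite mulf_eq0 (negbTE a_neq0) => /eqP.
    have -> : z * dot e2 n = - q / a.
      by rewrite -[q](addrK (a * (z * dot e2 n))) q0; field.
    by field; rewrite ?a_neq0 ?qn0.
apply: e2D; exists 0; apply/GP; rewrite raddf0.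
by move: mE; rewrite -xm x0 raddf0 !scaler0 addr0.
Qed.

End RankOne.

(** * Pairings through A^{-1/2} and the number q *)

Section RootPairings.
Set Implicit Arguments.
Unset Strict Implicit.
Variables (R : realType) (H : completeNormedModType (CC R)).
Local Notation C := (CC R).
Variable dot : {dot H for Num.conj}.
Hypothesis hdot : hilbert dot.
Variable A : set (H * H).
Hypothesis hA : selfadjoint dot A.
Variables (G : {linear H -> H}) (M : C).
Hypothesis GP : forall x y, A (x, y) <-> x = G y.
Hypothesis M_ge0 : 0 <= M.
Hypothesis G_bound : forall y, `|G y| <= M * `|y|.
Hypothesis G_ge0 : forall y, 0 <= dot (G y) y.
Variable rootA : set (H * H).
Hypothesis hrootA : is_sqrt dot A rootA.
Variable F : {linear H -> H}.
Hypothesis FP : forall x y, rootA (x, y) <-> x = F y.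
Hypothesis F_sym : forall x y, dot (F x) y = dot x (F y).
Hypothesis FF : forall x, F (F x) = G x.

Let Gsym x y : dot (G x) y = dot x (G y).
Proof. exact: (inverse_sym hA GP). Qed.

Lemma rootA_fun x y y' : rootA (x, y) -> rootA (x, y') -> y = y'.
Proof. by case: hrootA => sa _ _; apply: (sa_fun hdot sa). Qed.

Lemma F_inj x y : F x = F y -> x = y.
Proof. by move=> xy; apply: (@rootA_fun (F x)); apply/FP. Qed.

Lemma F_sqnorm y : `|F y| ^+ 2 = dot (G y) y.
Proof. by rewrite -(hdot (F y)) -FF F_sym F_sym. Qed.

Lemma F_bound y : `|F y| <= (1 + M) * `|y|.
Proof.
have M1 : 0 <= 1 + M by rewrite addr_ge0.
rewrite -ler_sqr ?nnegrE ?mulr_ge0// F_sqnorm -[leLHS]ger0_norm//.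
apply: (le_trans (cauchy_schwarz hdot _ _)).
apply: (@le_trans _ _ (M * `|y| ^+ 2)).
  by rewrite expr2 mulrA ler_wpM2r.
rewrite exprMn ler_wpM2r ?exprn_ge0//.
rewrite sqrrD expr1n mul1r mulr2n -subr_ge0.
have -> : 1 + (M + M) + M ^+ 2 - M = 1 + M + M ^+ 2 by ring.
by rewrite !addr_ge0 ?exprn_ge0.
Qed.

Lemma cvg_F (u : nat -> H) (a : H) : u n @[n --> \oo] --> a ->
  F (u n) @[n --> \oo] --> F a.
Proof.
by apply: (@cvg_dominated _ _ _ (1 + M)) => n; rewrite -(raddfB F) F_bound.
Qed.

(* Both sides are [((1 + G^2)^{-1} G f1, f2)]. *)
Lemma pairing_swap f1 f2 g1 g2 : g1 = G (f1 - G g1) -> g2 = G (f2 - G g2) ->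
  dot g2 f1 = dot f2 g1.
Proof.
move=> h1 h2.
rewrite -[f1](subrK (G g1)) -[f2](subrK (G g2)) dotDr dotDl Gsym.
congr (_ + _); transitivity (dot (G (f2 - G g2)) (f1 - G g1)).
  by rewrite -h2.
by rewrite Gsym -h1.
Qed.

(** * The regularized pairing *)

Section Singular.
Variable rootA2 : set (H * H).
Hypothesis hrootA2 : is_sqrt dot (invA2 A) rootA2.

(** Write p_i for A^{1/2} (A^2 + 1)^{-1/2} f_i, so that F p_i = s f_i, and let F y_n tend to f1.
    Then (p2, s y_n) = (s p2, y_n) = (F g, y_n) = (g, F y_n), and the limit is taken on both
    sides. *)
Lemma root_pairing f1 f2 g : g = G (f2 - G g) ->
  regularized dot rootA rootA2 f1 f2 = dot g f1.
Proof.
move=> gE.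
have [N NP] := sqr1_inverse hdot hA.
have invN x y : invA2 A (x, y) <-> y = N x by exact: NP.
have [s [sP s_sym s_ge0 ss]] := sqrt_total hdot hrootA2 invN.
have Nuniq x f : x = G (G (f - x)) -> x = N f.
  move=> xE; apply/NP; rewrite /gshift /= scaleN1r.
  by exists (G (f - x)); apply/GP.
have NE f : N f = G (G (f - N f)).
  have := (NP (N f) f).2 erefl; rewrite /gshift /= scaleN1r.
  by move=> -[p /= /GP xp /GP pf]; rewrite -pf.
have Ngg f : dot (N f) f = `|N f| ^+ 2 + `|G (f - N f)| ^+ 2.
  rewrite -[X in dot _ X](subrK (N f)) dotDr addrC (hdot (N f)); congr (_ + _).
  by rewrite {1}NE Gsym -hdot.
have N_le1 f : `|N f| <= `|f|.
  apply: norm_le_of_sqr => //; rewrite mulrC.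
  have h : `|N f| ^+ 2 <= dot (N f) f by rewrite Ngg lerDl exprn_ge0.
  apply: (le_trans h); rewrite -[leLHS]ger0_norm ?(le_trans _ h) ?exprn_ge0//.
  exact: cauchy_schwarz.
have s_sqnorm x : `|s x| ^+ 2 = dot (N x) x.
  by rewrite -(hdot (s x)) -ss s_sym s_sym.
have s_le1 x : `|s x| <= `|x|.
  rewrite -ler_sqr ?nnegrE// s_sqnorm -[leLHS]ger0_norm.
    apply: (le_trans (cauchy_schwarz hdot _ _)).
    by rewrite expr2 ler_wpM2r.
  by rewrite -s_sqnorm exprn_ge0.
have s_inj x : s x = 0 -> x = 0.
  move=> sx; have Nx : N x = 0 by rewrite -ss sx raddf0.
  have := NE x; rewrite Nx subr0 => /esym h.
  by do 2 apply: (G_inj hdot hA GP); rewrite h !raddf0.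
have FG x : F (G x) = G (F x) by rewrite -!FF.
have FN x : F (N x) = N (F x).
  by apply: Nuniq; rewrite {1}NE !FG (raddfB F) /=.
have M1 : 0 <= 1 + M by rewrite addr_ge0.
have sF x : F (s x) = s (F x).
  apply: (sqrt_commute hdot s_sym s_ge0 s_le1 s_inj M1 F_bound) => y.
  by rewrite !ss FN.
(* This bounds A^{1/2} (A^2 + 1)^{-1/2}, which sends [F y] to [s y], on the dense range of [F];
   hence it is defined everywhere. *)
have sleF y : `|s y| <= (1 + M + M) * `|F y|.
  have K0 : 0 <= M + M by rewrite addr_ge0.
  have K1 : 0 <= 1 + M + M by rewrite -addrA addr_ge0.
  rewrite -ler_sqr ?nnegrE ?mulr_ge0// s_sqnorm.
  have -> : dot (N y) y = dot (G (F y - N (F y))) (F y).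
    rewrite {1}NE -[X in dot X y]FF F_sym FG (raddfB F) /=.
    by rewrite FN.
  apply: (@le_trans _ _ ((M + M) * `|F y| ^+ 2)); last first.
    rewrite exprMn ler_wpM2r ?exprn_ge0// -subr_ge0.
    have -> : (1 + M + M) ^+ 2 - (M + M) = 1 + (M + M) + (M + M) ^+ 2 by ring.
    by rewrite !addr_ge0 ?exprn_ge0.
  have h : 0 <= dot (G (F y - N (F y))) (F y).
    rewrite -[X in dot _ X](subrK (N (F y))) dotDr addr_ge0//.
    have <- : dot (G (G (F y - N (F y)))) (G (F y - N (F y))) =
        dot (G (F y - N (F y))) (N (F y)) by rewrite Gsym -NE.
    exact: G_ge0.
  rewrite -[leLHS]ger0_norm//; apply: (le_trans (cauchy_schwarz hdot _ _)).
  rewrite expr2 mulrA ler_wpM2r//; apply: (le_trans (G_bound _)).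
  rewrite mulrDl -mulrDr ler_wpM2l//.
  by apply: (le_trans (ler_normB _ _)); rewrite lerD2l.
have Fdense : dense (range F).
  case: hrootA => -[dD _] _ _; move=> O O0 oO.
  by have [x [Ox [y /FP xy]]] := dD O O0 oO; exists x; split => //; exists y.
have lim e : exists p, [/\ F p = s e, gcomp rootA rootA2 (e, p) &
    exists2 y : nat -> H, F (y n) @[n --> \oo] --> e & s (y n) @[n --> \oo] --> p].
  have [y ye] := dense_range_seq Fdense e.
  have [p yp] := dominated_limit sleF ye.
  have Fp : F p = s e.
    apply: (cvg_seq_unique (cvg_F yp)); under eq_fun do rewrite sF.
    apply: (@cvg_dominated _ _ _ 1 _ _ _ _ _ ye) => n; rewrite -(raddfB s) mul1r.
    exact: s_le1.
  exists p; split => //; last by exists y.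
  by exists (s e); [exact/sP|apply/FP].
have apE e p : gcomp rootA rootA2 (e, p) -> F p = s e ->
    ap 0 (gcomp rootA rootA2) e = p.
  move=> ep Fp; apply: ap_eq => // p' [t /= /sP -> /FP sp'].
  by apply: F_inj; rewrite Fp.
have [p1 [Fp1 g1 [y ye yp]]] := lim f1; have [p2 [Fp2 g2 _]] := lim f2.
rewrite /regularized (apE f1 p1)// (apE f2 p2)//.
have sp2 : s p2 = F g.
  apply: F_inj; rewrite sF Fp2 ss FF; apply/esym/Nuniq.
  by rewrite {1}gE.
apply: (cvg_seq_unique (cvg_dotr hdot (x := p2) yp)).
under eq_fun do rewrite -s_sym sp2 F_sym.
exact: (cvg_dotr hdot).
Qed.

End Singular.

(** * The pairing of H_{+1} with H_{-1} and the value of tau *)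

Section Regular.
Variables (rootA1 : set (H * H)) (S : scale A rootA1) (J : {linear H -> H}).
Hypothesis hrootA1 : is_sqrt dot (invA1 A) rootA1.
Hypothesis JP : forall x y, gshift A (- 1) (x, y) <-> x = J y.
Local Notation eta := Defs.eta.
Local Notation incl := Defs.incl.

(** Lets A^{-1/2} extend to H_{-1}. With t = J f one has (G f, f) = (t, f) + (t, t) + (t, G t), and
    the last two terms are at most (t, f) and M (t, f). *)
Lemma F_le_emb1 f : `|F f| <= (2 + M) * `|emb1 S f|.
Proof.
have invJ x y : invA1 A (x, y) <-> y = J x by exact: JP.
have [r [rP r_sym _ rr]] := sqrt_total hdot hrootA1 invJ.
have -> : `|emb1 S f| = `|r f|.
  have [-> _] := emb1P S; congr `|_|; apply: ap_eq; first exact/rP.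
  by move=> y /rP.
have K0 : 0 <= 2 + M by rewrite addr_ge0.
rewrite -ler_sqr ?nnegrE ?mulr_ge0// exprMn F_sqnorm.
have -> : `|r f| ^+ 2 = dot (J f) f by rewrite -(hdot (r f)) -rr r_sym r_sym.
have fE : f = (f - J f) + J f by rewrite subrK.
set t := J f; have tE : t = G (f - t) := J_G GP JP f.
have tt : dot t t <= dot t f.
  by rewrite -subr_ge0 -dotBr {1}tE.
have tG : dot t (G t) <= M * dot t t.
  rewrite -[leLHS]ger0_norm -?Gsym//; apply: (le_trans (cauchy_schwarz hdot _ _)).
  by rewrite (hdot t) expr2 mulrA ler_wpM2r.
apply: (@le_trans _ _ ((2 + M) * dot t f)).
  rewrite (G_split GP JP f) dotDl -/t Gsym (G_split GP JP f) -/t dotDr.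
  have -> : (2 + M) * dot t f = dot t f + (dot t f + M * dot t f) by ring.
  by rewrite lerD2l lerD// (le_trans tG)// ler_wpM2l.
rewrite ler_wpM2r ?(le_trans (dot_ge0 hdot t) tt)// expr2 ler_peMl//.
by rewrite -[leLHS]addr0 lerD// ler1n.
Qed.

Lemma dual1_root b b2 (v : Hm1 S) : rootA (eta (incl S v), b2) ->
  dual dot (@emb1 _ _ _ _ S) (F b) v = dot b b2.
Proof.
move=> /FP vE.
have lim f : emb1 S (f n) @[n --> \oo] --> v ->
    (dot (F b) (f n) : C^o) @[n --> \oo] --> (dot b b2 : C^o).
  move=> fv; have [l fl] := dominated_limit F_le_emb1 fv.
  have jf : emb2 S (f n) @[n --> \oo] --> incl S v.
    under eq_fun do rewrite -incl_emb.
    by apply: continuous_cvg => //; exact: incl_continuous.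
  (* [F l] is the limit of [G (f n)], that is [eta (incl S v)] = [F b2]. *)
  have lE : l = b2.
    apply: F_inj; rewrite -vE.
    have Gf := eta_spec GP G_bound JP jf.
    apply: (@cvg_seq_unique _ _ (fun n => G (f n))) Gf.
    by under eq_fun do rewrite -FF; apply: cvg_F.
  by under eq_fun do rewrite F_sym; apply: (cvg_dotr hdot); rewrite -lE.
have [f fv] := dense_range_seq (proj2 (emb1P S)) v; apply: ap_eq.
  by exists f, (fun n => dot (F b) (f n)); split => //; exact: lim.
move=> y [u [c [/= uc /lim uv cy]]].
have cE : c = (fun n => dot (F b) (u n)) by apply/funext => n; rewrite uc.
have cy' : (c n : C^o) @[n --> \oo] --> (y : C^o) by exact: cy.
by rewrite cE in cy'; exact: (cvg_seq_unique cy' uv).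
Qed.

(** With g_i = extA2 w_i one has A g1 = F (b1 - F g1), so the first term is (b2, b1) - (eta w2, g1),
    and [pairing_swap] cancels the subtracted part against the second. *)
Lemma tau_pairing (w1 w2 : Hm2 S) (v2 : Hm1 S) b1 b2 : incl S v2 = w2 ->
  rootA (eta w1, b1) -> rootA (eta w2, b2) ->
  (dual dot (@emb1 _ _ _ _ S) (ap 0 A (extA2 w1)) v2)^* +
    dot (extA2 w2) (eta w1) = dot b2 b1.
Proof.
move=> <- /FP e1E /[dup] h2 /FP e2E.
have g1E := extA2_spec hdot hA GP G_bound JP w1.
have g2E := extA2_spec hdot hA GP G_bound JP (incl S v2).
have -> : ap 0 A (extA2 w1) = F (b1 - F (extA2 w1)).
  rewrite (raddfB F) /= FF -e1E; apply: ap_eq; first exact/GP.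
  move=> y /GP gy; apply: (G_inj hdot hA GP).
  by rewrite -g1E.
rewrite (dual1_root _ h2) -dotC dotBr (pairing_swap g1E g2E) e2E.
by rewrite F_sym subrK.
Qed.

End Regular.
End RootPairings.

(** * The eigenvector relations at regular points *)

Theorem theorem2
  (R : realType) (H : completeNormedModType (CC R))
  (dot : {dot H for Num.conj})
  (hdot : hilbert dot) (hsep : separable_space H)
  (A : set (H * H)) (hA : selfadjoint dot A) (hApos : strictly_positive dot A)
  (rootA rootA1 rootA2 : set (H * H))
  (hrootA : is_sqrt dot A rootA)
  (hrootA1 : is_sqrt dot (invA1 A) rootA1)
  (hrootA2 : is_sqrt dot (invA2 A) rootA2)
  (S : scale A rootA1)
  (w1 w2 : Hm2 S)
  (hw1 : ~ range (emb2 S) w1) (hw2 : ~ range (emb2 S) w2) (hw : w1 <> w2)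
  (alpha tau : CC R) (halpha : alpha != 0)
  (T : set (H * H)) (hT : in_P_tau dot rootA rootA2 w1 w2 alpha tau T)
  (lambda : CC R)
  (hlT : point_spectrum T lambda) (hlA : ~ point_spectrum A lambda) :
  (forall phi0 : H, eigenvector T lambda phi0 ->
     exists2 c : CC R, c != 0 &
       let phi := c *: phi0 in
       forall z : CC R, regular_points A z -> regular_points T z ->
         (lambda - z) * b_ dot w1 w2 alpha tau z * dot phi (n_ w1 z^*) = 1 /\
         gcomp (gshift A z) (ginv (gshift A lambda)) (m_ w2 z, phi)) /\
  (forall psi0 : H, eigenvector (gadj dot T) lambda^* psi0 ->
     exists2 c : CC R, c != 0 &
       let psi := c *: psi0 in
       forall z : CC R, regular_points A z -> regular_points T z ->
         (lambda^* - z^*) * (b_ dot w1 w2 alpha tau z)^* * dot psi (m_ w2 z)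
           = 1 /\
         gcomp (gshift A z^*) (ginv (gshift A lambda^*)) (n_ w1 z^*, psi)).
Proof.
have [res0 res1] := strictly_positive_resolvent hdot hA hApos.
have [G [GP0 [M M0 Gb]]] := resolvent_inverse hA res0.
have GP x y : A (x, y) <-> x = G y.
  by rewrite -GP0 /gshift /= scale0r addr0.
have [J [JP _]] := resolvent_inverse hA res1.
have G_ge0 y : 0 <= dot (G y) y.
  have [c c0 cP] := hApos.
  rewrite (inverse_sym hA GP).
  apply: le_trans (cP (G y) y _); last exact/GP.
  by rewrite mulr_ge0 ?(ltW c0)// dot_ge0.
have [F [FP F_sym FF]] := sqrt_inverse hrootA GP.
pose e1 := Defs.eta w1; pose e2 := Defs.eta w2.
pose k := dot (extA2 w2) e1.
(* From here on the two cases of [in_P_tau] are treated together. *)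
have [q TE qE] : exists2 q, T = perturbation dot A e1 (alpha *: e2) q &
    q = 1 + alpha * (tau + k).
  case: hT => [[[b1 eb1] [b2 eb2] [v2 v2E tauE] ->]|[_ ->]]; eexists => //.
    rewrite tauE (tau_pairing hdot hA GP M0 Gb G_ge0 hrootA FP F_sym FF hrootA1
      JP v2E eb1 eb2).
    have apE e b : rootA (e, b) -> ap 0 rootA e = b.
      by move=> eb; apply: ap_eq => // y /(rootA_fun hdot hrootA eb).
    by rewrite (apE _ _ eb1) (apE _ _ eb2).
  rewrite (root_pairing hdot hA GP M0 Gb G_ge0 hrootA FP F_sym FF hrootA2 e1
    (extA2_spec hdot hA GP Gb JP w2)).
  by [].
have e1D : ~ gdom A e1.
  by move=> [x] /(range_emb2 hdot GP Gb G_ge0 JP).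
have e2D : ~ gdom A e2.
  by move=> [x] /(range_emb2 hdot GP Gb G_ge0 JP).
have e10 : e1 != 0.
  by apply/eqP => e10; apply: e1D; exists 0; rewrite e10; exact: (sa0 hA).
have mE z : regular_points A z -> m_ w2 z = e2 + z *: G (m_ w2 z).
  by move=> /regular_resolvent /(extR_spec hA GP Gb JP w2).
have nE z : regular_points A z -> n_ w1 z^* = e1 + z^* *: G (n_ w1 z^*).
  by move=> /regular_resolvent /(resolvent_conj hdot hA) /(extR_spec hA GP Gb JP w1).
have bE z : regular_points A z ->
    b_ dot w1 w2 alpha tau z =
    - (alpha / (q + alpha * (z * dot e2 (n_ w1 z^*)))).
  move=> /nE nE'; rewrite /b_ (b_bracket hdot hA GP Gb G_ge0 JP w2 nE').
  rewrite -[alpha / _]invf_div; congr (- _^-1).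
  by rewrite qE /k; field.
rewrite {hT}TE in hlT *; split.
- move=> phi0 /(right_eigenvector GP halpha hlA)[c c0 [phiE qphi]].
  exists c => // phi z zA zT; rewrite -/phi in phiE qphi.
  have q0 := bracket_neq0 hA GP halpha e2D zT (mE z zA) (nE z zA).
  split; last first.
    exact: (resolvent_ratio GP (regular_resolvent zA) (mE z zA) phiE).
  (* By [qphi], lambda (phi, e1) - z (e2, n) = - (q + alpha z (e2, n)) / alpha, the inverse of
     b_z. *)
  rewrite (bE z zA) mulrAC (pairing hA GP phiE (nE z zA)).
  move: q0; set n := n_ _ _ => q0.
  have -> : lambda * dot phi e1 = - q / alpha by rewrite qphi; field.
  by field; rewrite halpha q0.
- move=> psi0 /(left_eigenvector hdot hA GP e10 hlA)[c c0 [psiE qpsi]].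
  exists c => // psi z zA zT; rewrite -/psi in psiE qpsi.
  have q0 := bracket_neq0 hA GP halpha e2D zT (mE z zA) (nE z zA).
  split; last first.
    apply: (resolvent_ratio GP _ (nE z zA) psiE).
    exact/(resolvent_conj hdot hA)/regular_resolvent.
  (* Conjugation turns (psi, m) into (m, psi), to which [pairing] applies with [m] at z and [psi] at
     lambda; z (m, e1) = z (e2, n) then brings back the same bracket. *)
  rewrite -[LHS]conjCK -[RHS](rmorph1 Num.conj); congr (_ ^*).
  rewrite !rmorphM rmorphB /= !conjCK -dotC (bE z zA) mulrAC.
  have h1 := pairing hA GP (mE z zA) psiE.
  have /esym/eqP := pairing hA GP (mE z zA) (nE z zA).
  rewrite subrr mul0r subr_eq0 => /eqP h2.
  rewrite -opprB mulNr h1 h2; move: q0; set n := n_ _ _ => q0.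
  have -> : lambda * dot e2 psi = - q / alpha by rewrite qpsi; field.
  by field; rewrite halpha q0.
Qed.
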